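(* Let $D\subset\mathbb C$ be a non-empty open set invariant under complex conjugation, with $\Omega_D$ connected, and let $f:\Omega_D\to A$ be any function. The following assertions hold. (i) If $D\cap\mathbb R=\emptyset$, then $f$ is a slice regular function if and only if $f$ is a $\sigma_A$-analytic slice function. (ii) If $D\cap\mathbb R\neq\emptyset$, then $f$ is a slice regular function if and only if $f$ is $\sigma_A$-analytic.
   Context: Algebra. $A$ is a finite-dimensional real alternative algebra with unity $1$ (so $\mathbb R\subset A$), equipped with a real linear anti-involution $x\mapsto x^c$ (so $(x^c)^c=x$, $(xy)^c=y^cx^c$). Put $t(x):=x+x^c$, $n(x):=xx^c$. The quadratic cone is $\mathcal Q_A:=\mathbb R\cup\{x\in A: t(x)\in\mathbb R,\ n(x)\in\mathbb R,\ 4n(x)>t(x)^2\}$; $\mathbb S_A:=\{J\in\mathcal Q_A: J^2=-1\}$ is assumed non-empty; for $J\in\mathbb S_A$, $\mathbb C_J:=\mathbb R+\mathbb RJ\simeq\mathbb C$. One has $\mathcal Q_A=\bigcup_{J}\mathbb C_J$ and $\mathbb C_I\cap\mathbb C_J=\mathbb R$ if $I\ne\pm J$. For $x\in\mathcal Q_A$: $\mathrm{Re}(x):=(x+x^c)/2\in\mathbb R$, $\mathrm{Im}(x):=(x-x^c)/2$. $A$ is equipped with a norm $\|\cdot\|_A$ such that $\|x\|_A=\sqrt{n(x)}$ for all $x\in\mathcal Q_A$; ''open'' in $\mathcal Q_A$ refers to the euclidean topology. Slice functions. For $D\subset\mathbb C$ non-empty, open and conjugation invariant, $\Omega_D:=\{\alpha+\beta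 J: \alpha,\beta\in\mathbb R,\ \alpha+i\beta\in D,\ J\in\mathbb S_A\}$. A stem function is a map $F=F_1+iF_2:D\to A\otimes_{\mathbb R}\mathbb C$ ($F_1,F_2$ $A$-valued) with $F_1(\bar z)=F_1(z)$, $F_2(\bar z)=-F_2(z)$. It induces the slice function $f=\mathcal I(F):\Omega_D\to A$, $f(\alpha+\beta J):=F_1(z)+JF_2(z)$, $z=\alpha+i\beta$. A slice function is slice regular if it is induced by a stem function $F$ of class $C^1$ which is holomorphic, i.e. $\frac{\partial F}{\partial\bar z}:=\frac12\big(\frac{\partial F}{\partial\alpha}+i\frac{\partial F}{\partial\beta}\big)=0$. Power series. For $y\in\mathcal Q_A$, $(x-y)^{\cdot n}$ is the value at $x\in\mathcal Q_A$ of the slice function induced by $z\mapsto(z-y)^n$, and, for $a\in A$, $(x-y)^{\cdot n}a$ is the value at $x$ of the slice function induced by $z\mapsto(z-y)^na$ (powers and products taken in $A\otimes_{\mathbb R}\mathbb C$). Metric. For $x,y\in\mathcal Q_A$, $y\in\mathbb C_J$: $\sigma_A(x,y):=\|x-y\|_A$ if $x\in\mathbb C_J$, and $\sigma_A(x,y):=\sqrt{|\mathrm{Re}(x)-\mathrm{Re}(y)|^2+(\|\mathrm{Im}(x)\|_A+\|\mathrm{Im}(y)\|_A)^2}$ if $x\notin\mathbb C_J$. This is a metric on $\mathcal Q_A$; the $\sigma_A$-ball centered at $y$ of radius $r$ is $\{x\in\mathcal Q_A:\sigma_A(x,y)<r\}$. Analyticity. A function $f:U\to A$ on a non-empty open subset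 $U$ of $\mathcal Q_A$ is $\sigma_A$-analytic if for each $y\in U$ there exist a non-empty $\sigma_A$-ball $\Sigma$ centered at $y$ and contained in $U$, and a series $\sum_{n\in\mathbb N}(x-y)^{\cdot n}a_n$ with $a_n\in A$, which converges to $f(x)$ for each $x\in\Sigma\cap U$. *)

(* Defs.v *)
From HB Require Import structures.
From mathcomp Require Import all_boot all_order all_algebra.
From mathcomp Require Import all_classical all_reals all_analysis.

Set Implicit Arguments.
Unset Strict Implicit.
Unset Printing Implicit Defensive.

Import Order.TTheory GRing.Theory Num.Theory.
Import numFieldNormedType.Exports.
Local Open Scope classical_set_scope.
Local Open Scope ring_scope.

(* The product is not associative, so the ring structures of MathComp do not
   apply. The reals are embedded in A by r |-> r *: one; [aone_neq0] makes this
   embedding injective. *)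
Record alt_star_alg (R : realType) (A : lmodType R) := AltStarAlg {
  aone : A;
  amul : A -> A -> A;
  aconj : A -> A;
  aone_neq0 : aone != 0;
  amul1x : forall x, amul aone x = x;
  amulx1 : forall x, amul x aone = x;
  amul_linearl : forall y, linear (amul^~ y);
  amul_linearr : forall x, linear (amul x);
  amul_altl : forall x y, amul x (amul x y) = amul (amul x x) y;
  amul_altr : forall x y, amul (amul y x) x = amul y (amul x x);
  aconj_linear : linear aconj;
  aconjK : forall x, aconj (aconj x) = x;
  aconjM : forall x y, aconj (amul x y) = amul (aconj y) (aconj x)
}.

Definition finite_dimensional (R : realType) (A : lmodType R) : Prop :=
  exists n, exists e : 'I_n -> A,
    forall x : A, exists c : 'I_n -> R, x = \sum_(i < n) c i *: e i.

Section Algebra.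
Context {R : realType} {A : normedModType R} (E : alt_star_alg A).

Local Notation "x ** y" := (amul E x y) (at level 40, left associativity).
Local Notation one := (aone E).

Definition atrace (x : A) : A := x + aconj E x.

Definition asqnorm (x : A) : A := x ** aconj E x.

Definition quadratic_cone : set A :=
  [set x | exists r : R, x = r *: one] `|`
  [set x | exists t n : R,
     [/\ atrace x = t *: one, asqnorm x = n *: one & 4 * n > t ^+ 2]].

Definition im_units : set A :=
  [set J | quadratic_cone J /\ J ** J = - one].

Definition slice_point (a b : R) (J : A) : A := a *: one + b *: J.

Definition slice_plane (J : A) : set A :=
  [set x | exists a b : R, x = slice_point a b J].

(* On the quadratic cone, Re takes values in the copy R *: one of the reals. *)
Definition aRe (x : A) : A := 2^-1 *: (x + aconj E x).
Definition aIm (x : A) : A := 2^-1 *: (x - aconj E x).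

Definition norm_compatible : Prop :=
  forall (x : A) (n : R),
    quadratic_cone x -> asqnorm x = n *: one -> `|x| = Num.sqrt n.

(* [`|aRe x - aRe y|] is the absolute value of a real number, since
   [`|r *: one| = `|r|] for a compatible norm. If y is real, it lies in every
   plane C_J, and the two formulas agree for all x. *)
Definition sigma_dist (x y : A) : R :=
  if `[< exists2 J, im_units J & slice_plane J y /\ slice_plane J x >]
  then `|x - y|
  else Num.sqrt (`|aRe x - aRe y| ^+ 2 + (`|aIm x| + `|aIm y|) ^+ 2).

Definition sigma_ball (y : A) (r : R) : set A :=
  [set x | quadratic_cone x /\ sigma_dist x y < r].

(* Complex numbers are the pairs (alpha, beta) = alpha + i beta of R * R; the
   elements a + i b of the complexification of A are the pairs (a, b) of A * A. *)
Definition cpx_conj (z : R * R) : R * R := (z.1, - z.2).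

Definition cpx_embed (z : R * R) : A * A := (z.1 *: one, z.2 *: one).

Definition alg_embed (a : A) : A * A := (a, 0).

Definition cmul (u v : A * A) : A * A :=
  (u.1 ** v.1 - u.2 ** v.2, u.1 ** v.2 + u.2 ** v.1).

Definition cimul (u : A * A) : A * A := (- u.2, u.1).

Definition cexp (u : A * A) (n : nat) : A * A := iter n (cmul u) (one, 0).

Definition Omega (D : set (R * R)) : set A :=
  [set x | exists a b J, [/\ D (a, b), im_units J & x = slice_point a b J]].

Definition stem (D : set (R * R)) (F : R * R -> A * A) : Prop :=
  forall z, D z ->
    (F (cpx_conj z)).1 = (F z).1 /\ (F (cpx_conj z)).2 = - (F z).2.

(* For a stem function F on D and x in Omega D, the set below is a singleton. *)
Definition slice_ext (F : R * R -> A * A) (x : A) : A :=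
  xget 0 [set w | exists a b J,
    [/\ im_units J, x = slice_point a b J &
        w = (F (a, b)).1 + J ** (F (a, b)).2]].

Definition induces (D : set (R * R)) (F : R * R -> A * A) (f : A -> A) : Prop :=
  stem D F /\ (forall x, Omega D x -> f x = slice_ext F x).

Definition slice_function (D : set (R * R)) (f : A -> A) : Prop :=
  exists F, induces D F f.

Definition class_C1 (D : set (R * R)) (F : R * R -> A * A) : Prop :=
  forall z, D z ->
    [/\ derivable F z (1, 0), derivable F z (0, 1),
        {for z, continuous ('D_(1, 0) F)} &
        {for z, continuous ('D_(0, 1) F)}].

Definition dbar (F : R * R -> A * A) (z : R * R) : A * A :=
  2^-1 *: ('D_(1, 0) F z + cimul ('D_(0, 1) F z)).

Definition slice_regular (D : set (R * R)) (f : A -> A) : Prop :=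
  exists F, [/\ induces D F f, class_C1 D F & forall z, D z -> dbar F z = 0].

(* The term (x - y)^{.n} a of a power series centred at y. *)
Definition slice_monomial (y : A) (n : nat) (a : A) : A -> A :=
  slice_ext (fun z =>
    cmul (cexp (cpx_embed z - alg_embed y) n) (alg_embed a)).

Definition sigma_analytic (U : set A) (f : A -> A) : Prop :=
  forall y, U y ->
    exists (r : R) (a : nat -> A),
      [/\ sigma_ball y r !=set0, sigma_ball y r `<=` U &
          forall x, (sigma_ball y r `&` U) x ->
            series (fun n => slice_monomial y n (a n) x) @ \oo --> f x].

End Algebra.

(* Main.v *)
(* For a unit J, left multiplication by J makes A a complex vector space, and a
   function f on Omega D restricts to G_J(a + ib) = f(a + bJ), a function with
   values in that space. The representation formula
     G_K(z) = (1 - KJ)/2 G_J(z) + (1 + KJ)/2 G_J(conj z)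
   holds for all units J, K exactly when f is a slice function, and the power
   (x - y)^{.n} a obeys it with G_J(z) = (z - w)^n a, where y lies over w in the
   plane of J. So a sigma-ball expansion of f at y is an ordinary power series
   for G_J at w, transported to the other planes by the formula.
   If f is slice regular, then G_J is holomorphic, hence analytic by Cauchy's
   formula. Conversely, power series make G_J holomorphic and of class C^1, and
   the stem function is recovered linearly from G_J(z) and G_J(conj z). If D meets
   the real line, the formula holds near a real point, where one expansion serves
   all planes, and the identity theorem propagates it over the connected domain. *)
Require Import Defs.
From HB Require Import structures.
From mathcomp Require Import all_boot all_order all_algebra.
From mathcomp Require Import all_classical all_reals all_analysis.
From mathcomp Require Import complex ring lra.
Import Order.TTheory GRing.Theory Num.Theory.
Import numFieldNormedType.Exports.
Local Open Scope classical_set_scope.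
Local Open Scope ring_scope.
Local Open Scope complex_scope.
Local Notation Re := (@complex.Re _).
Local Notation Im := (@complex.Im _).
Import ComplexField.Normc.

(** * Integration over a circle *)

(** Cauchy's formula is proved for two real functions u, v with integrals over [0, 2 pi], and
    reaches A coordinate by coordinate: l(v) - i l(Jv) is a complex linear functional whenever l is
    a real linear one. Truncating the geometric series of the Cauchy kernel removes its pole, so the
    circle can be contracted right down to the evaluation point and only the truncation error has to
    be controlled. For the converse, class C^1 comes from strict differentiability of power series,
    a notion stable under linear maps and conjugation which on an open set makes derivatives
    continuous. Connectedness is given for Omega D and not for D. The map (Re x, |Im x|) leads back
    to D but forgets the sign of the imaginary part, so the set on which the representation formula
    holds is made conjugation invariant before it is pulled back. *)

Section CircleIntegral.
Context {R : realType}.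
Implicit Types (f g F : R -> R) (c : R).

Definition circle_int f : R :=
  \int[lebesgue_measure]_(x in `[0, 2 * pi]%classic) f x.

Lemma pi2_gt0 : 0 < 2 * pi :> R.
Proof. by rewrite mulr_gt0 ?pi_gt0. Qed.

Lemma circle_integrable f : continuous f ->
  lebesgue_measure.-integrable `[0, 2 * pi : R]%classic (EFin \o f).
Proof.
move=> cf; apply: continuous_compact_integrable; first exact: segment_compact.
exact: continuous_subspaceT.
Qed.

Lemma circle_intD f g : continuous f -> continuous g ->
  circle_int (fun x => f x + g x) = circle_int f + circle_int g.
Proof.
by move=> cf cg; rewrite /circle_int RintegralD//; exact: circle_integrable.
Qed.

Lemma circle_intZ c f : continuous f ->
  circle_int (fun x => c * f x) = c * circle_int f.
Proof.
by move=> cf; rewrite /circle_int RintegralZl//; exact: circle_integrable.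
Qed.

Lemma circle_int_cst c : circle_int (fun=> c) = c * (2 * pi).
Proof.
rewrite /circle_int Rintegral_cst//= lebesgue_measure_itv/= lte_fin pi2_gt0.
by rewrite sube0.
Qed.

Lemma circle_int_norm_le f c : continuous f -> (forall x, `|f x| <= c) ->
  `|circle_int f| <= c * (2 * pi).
Proof.
move=> cf fc; rewrite -circle_int_cst.
apply: (le_trans (le_normr_Rintegral _ _)) => //; first exact: circle_integrable.
have cn : continuous (fun x => `|f x|).
  by move=> x; apply: (@continuous_comp _ _ _ f); [exact: cf|exact: norm_continuous].
apply: le_Rintegral => //; first exact: circle_integrable.
by apply: circle_integrable => x; exact: cst_continuous.
Qed.

Lemma circle_int_FTC F f : continuous f -> (forall x : R, is_derive x 1 F (f x)) ->
  circle_int f = F (2 * pi) - F 0.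
Proof.
move=> cf dF; rewrite /circle_int /Rintegral.
have cF : continuous F.
  by move=> x; have [/derivable1_diffP/differentiable_continuous] := dF x.
rewrite (@continuous_FTC2 _ f F)//; first exact: pi2_gt0.
- exact: continuous_subspaceT.
- split.
  + by move=> x _; have [] := dF x.
  + exact/cvg_at_right_filter/cF.
  + exact/cvg_at_left_filter/cF.
- by move=> x _; rewrite derive1E; have [_ ->] := dF x.
Qed.

(** Differentiation under the integral sign; the interval of integration has finite measure, so the
    constant [M] serves as dominating function. *)
Lemma circle_int_is_derive (f df : R -> R -> R) (a u v M : R) :
  u < a < v ->
  (forall x, u < x < v -> continuous (f x)) ->
  (forall x y, u < x < v -> is_derive x 1 (f^~ y) (df x y)) ->
  (forall x y, u < x < v -> `|df x y| <= M) ->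
  is_derive a 1 (fun x => circle_int (f x)) (circle_int (df a)).
Proof.
move=> auv cf ddf dfM.
have Ia : `]u, v[%classic a by rewrite /= in_itv.
have mB : measurable `[0, 2 * pi : R]%classic by [].
have M0 : 0 <= M by exact: le_trans (normr_ge0 _) (dfM a 0 auv).
have cM : continuous (fun _ : R => M) by move=> x; exact: cst_continuous.
have dE x y : u < x < v -> partial1of2 f x y = df x y.
  by move=> xuv; rewrite partial1of2E; have [_ ->] := ddf x y xuv.
have H1 x : `]u, v[%classic x ->
  lebesgue_measure.-integrable `[0, 2 * pi : R]%classic (EFin \o f x).
  by rewrite /= in_itv/= => xuv; exact/circle_integrable/cf.
have H2 x y : `]u, v[%classic x -> `[0, 2 * pi : R]%classic y ->
    derivable (f^~ y) x 1.
  by rewrite /= in_itv/= => xuv _; have [] := ddf x y xuv.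
have H3 x y : `]u, v[%classic x -> `[0, 2 * pi : R]%classic y ->
    `|partial1of2 f x y| <= M.
  by rewrite /= in_itv/= => xuv _; rewrite dE// dfM.
apply: DeriveDef.
  have := @derivable_under_integral _ _ _ lebesgue_measure f _ mB _ _ _ Ia H1 H2
    _ (fun=> M0) (circle_integrable _ cM) H3.
  exact.
rewrite -derive1E (@differentiation_under_integral _ _ _ lebesgue_measure f _ mB
  _ _ _ Ia H1 H2 _ (fun=> M0) (circle_integrable _ cM) H3).
by apply: eq_Rintegral => y _; rewrite dE.
Qed.

End CircleIntegral.

Lemma cvg_pair_nbhs {T : Type} {U V : topologicalType} (F : set_system T)
  {FF : Filter F} (f : T -> U) (g : T -> V) (a : U) (b : V) :
  f x @[x --> F] --> a -> g x @[x --> F] --> b ->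
  (f x, g x) @[x --> F] --> (a, b).
Proof. by move=> fa gb; apply: cvg_pair fa gb. Qed.

(** * The chain rule for functions of two real variables *)

Section ChainRule.
Context {R : realType}.

(** Locating [c] by its distance to [p] treats both orders of [p] and [x] at once, the case x = p
    included. *)
Lemma MVT_between (f df : R -> R) (p x : R) :
  (forall c, `|c - p| <= `|x - p| -> is_derive c 1 f (df c)) ->
  exists2 c, `|c - p| <= `|x - p| & f x - f p = df c * (x - p).
Proof.
move=> fdf; have [xp|px] := leP x p.
- have cle c : c \in `[x, p] -> `|c - p| <= `|x - p|.
    by rewrite in_itv/= => /andP[? ?]; rewrite !ler0_norm ?subr_le0//; lra.
  have fd c : c \in `[x, p] -> is_derive c 1 f (df c) by move=> /cle /fdf.
  have fdo c : c \in `]x, p[ -> is_derive c 1 f (df c).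
    by move=> cxp; apply: fd; exact: subset_itv_oo_cc cxp.
  have fc : {within `[x, p], continuous f}.
    by apply: derivable_within_continuous => c /fd[].
  have [c cxp fE] := MVT_segment xp fdo fc.
  by exists c; [exact: cle|rewrite -[LHS]opprB fE -mulrN opprB].
- have cle c : c \in `[p, x] -> `|c - p| <= `|x - p|.
    by rewrite in_itv/= => /andP[? ?]; rewrite !ger0_norm ?subr_ge0//; lra.
  have fd c : c \in `[p, x] -> is_derive c 1 f (df c) by move=> /cle /fdf.
  have fdo c : c \in `]p, x[ -> is_derive c 1 f (df c).
    by move=> cxp; apply: fd; exact: subset_itv_oo_cc cxp.
  have fc : {within `[p, x], continuous f}.
    by apply: derivable_within_continuous => c /fd[].
  have [c cxp fE] := MVT_segment (ltW px) fdo fc.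
  by exists c; [exact: cle|].
Qed.

(* This factorization reduces the chain rule to the continuity of a composition. *)
Lemma caratheodory2 (u a b : R * R -> R) (z0 : R * R) :
  (\forall z \near z0,
     is_derive (z.1 : R) 1 (fun x : R => u (x, z.2)) (a z) /\
     is_derive (z.2 : R) 1 (fun y : R => u (z.1, y)) (b z)) ->
  {for z0, continuous a} -> {for z0, continuous b} ->
  exists A B : R * R -> R,
    [/\ forall z, u z - u z0 = A z * (z.1 - z0.1) + B z * (z.2 - z0.2),
        {for z0, continuous A}, {for z0, continuous B},
        A z0 = a z0 & B z0 = b z0].
Proof.
move: z0 => [p q] /nbhs_ballP[e /= e0 ube] ca cb.
(* Near z0, the increment is split into a horizontal step from (p, y) to (x, y) and a vertical step
   from (p, q) to (p, y), each given by the mean value theorem. *)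
pose ok (z : R * R) (AB : R * R) := u z - u (p, q) = AB.1 * (z.1 - p) + AB.2 * (z.2 - q) /\
  (ball (p, q) e z -> exists c1 c2,
    [/\ `|c1 - p| <= `|z.1 - p|, `|c2 - q| <= `|z.2 - q|,
        AB.1 = a (c1, z.2) & AB.2 = b (p, c2)]).
have /choice[AB ABok] : forall z, exists AB, ok z AB.
  move=> [x y]; have [[/= px qy]|nb] := pselect (ball (p, q) e (x, y)).
  - have [|c1 c1x h1] := @MVT_between (fun x => u (x, y)) (fun x => a (x, y)) p x _.
      move=> c cx; apply: (ube (c, y) _).1; split => //=.
      move: px; rewrite /ball/= => px; rewrite distrC (le_lt_trans cx)//.
      by rewrite distrC.
    have [|c2 c2y h2] := @MVT_between (fun y => u (p, y)) (fun y => b (p, y)) q y _.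
      move=> c cy; apply: (ube (p, c) _).2; split => //=; first exact: ballxx.
      move: qy; rewrite /ball/= => qy; rewrite distrC (le_lt_trans cy)//.
      by rewrite distrC.
    exists (a (c1, y), b (p, c2)); split => /=; last by move=> _; exists c1, c2.
    by rewrite -h1 -h2; ring.
  (* Away from z0 any solution of the identity will do: a difference quotient in a coordinate that
     differs. *)
  - have [xp|xp] := eqVneq x p; last first.
      exists ((u (x, y) - u (p, q)) / (x - p), 0); split => //=.
      by rewrite mul0r addr0 divfK// subr_eq0.
    have [yq|yq] := eqVneq y q; last first.
      exists (0, (u (x, y) - u (p, q)) / (y - q)); split => //=.
      by rewrite mul0r add0r divfK// subr_eq0.
    by exfalso; apply: nb; rewrite xp yq; exact: ballxx.
(* At z0 itself the intermediate points are forced to be [p] and [q], which fixes the values of A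
   and B there. *)
have e00 : ball (p, q) e (p, q) by exact: ballxx.
have [A0 B0] : (AB (p, q)).1 = a (p, q) /\ (AB (p, q)).2 = b (p, q).
  have [_ /(_ e00)[c1 [c2 []]]] := ABok (p, q).
  by rewrite /= !subrr normr0 !normr_le0 !subr_eq0 => /eqP-> /eqP-> -> ->.
exists (fun z => (AB z).1), (fun z => (AB z).2); split; [|idtac|idtac|exact: A0|exact: B0].
- by move=> z; have [] := ABok z.
- apply/cvgrPdist_lt => eps eps0 /=; rewrite A0.
  move/cvgrPdist_lt : ca => /(_ _ eps0) /nbhs_ballP[d /= d0 da].
  have de0 : 0 < Num.min d e by rewrite lt_min d0.
  apply: filterS (nbhsx_ballx (p, q) _ de0).
  move=> [x y] xy; have xye : ball (p, q) e (x, y).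
    by apply: le_ball xy; rewrite ge_min lexx orbT.
  have [_ /(_ xye)[c1 [c2 [/= c1x _ -> _]]]] := ABok (x, y).
  have [/= px py] : ball (p, q) d (x, y) by apply: le_ball xy; rewrite ge_min lexx.
  apply: da; split => //=; move: px; rewrite /ball/= => px.
  by rewrite distrC (le_lt_trans c1x)// distrC.
- apply/cvgrPdist_lt => eps eps0 /=; rewrite B0.
  move/cvgrPdist_lt : cb => /(_ _ eps0) /nbhs_ballP[d /= d0 da].
  have de0 : 0 < Num.min d e by rewrite lt_min d0.
  apply: filterS (nbhsx_ballx (p, q) _ de0).
  move=> [x y] xy; have xye : ball (p, q) e (x, y).
    by apply: le_ball xy; rewrite ge_min lexx orbT.
  have [_ /(_ xye)[c1 [c2 [/= _ c2y _ ->]]]] := ABok (x, y).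
  have [/= px py] : ball (p, q) d (x, y) by apply: le_ball xy; rewrite ge_min lexx.
  apply: da; split => //=; first exact: ballxx.
  by move: py; rewrite /ball/= => py; rewrite distrC (le_lt_trans c2y)// distrC.
Qed.

Lemma is_derive_continuous (f : R -> R) (t d : R) : is_derive t 1 f d ->
  {for t, continuous f}.
Proof. by move=> [/derivable1_diffP/differentiable_continuous]. Qed.

(** If G1 and G2 are the slope functions of g1 and g2 at [t], then A G1 + B G2, with A and B taken
    along the curve, is a slope function of the composite, and it is continuous at [t]. *)
Lemma is_derive_chain2 (u a b : R * R -> R) (g1 g2 : R -> R) (t d1 d2 : R) :
  (\forall z \near (g1 t, g2 t),
     is_derive (z.1 : R) 1 (fun x : R => u (x, z.2)) (a z) /\
     is_derive (z.2 : R) 1 (fun y : R => u (z.1, y)) (b z)) ->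
  {for (g1 t, g2 t), continuous a} -> {for (g1 t, g2 t), continuous b} ->
  is_derive t 1 g1 d1 -> is_derive t 1 g2 d2 ->
  is_derive t 1 (fun s => u (g1 s, g2 s))
    (a (g1 t, g2 t) * d1 + b (g1 t, g2 t) * d2).
Proof.
move=> uab ca cb g1d g2d.
have [A [B [uE cA cB A0 B0]]] := caratheodory2 _ _ _ _ uab ca cb.
have cg : (g1 s, g2 s) @[s --> t] --> (g1 t, g2 t).
  exact: cvg_pair_nbhs (is_derive_continuous _ _ _ g1d) (is_derive_continuous _ _ _ g2d).
have /is_derive1_caratheodory[G1 [g1E cG1 G1t]] := g1d.
have /is_derive1_caratheodory[G2 [g2E cG2 G2t]] := g2d.
apply/is_derive1_caratheodory.
exists (fun s => A (g1 s, g2 s) * G1 s + B (g1 s, g2 s) * G2 s); split.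
- by move=> s; rewrite uE /= g1E g2E; ring.
- have cAg : A (g1 s, g2 s) @[s --> t] --> A (g1 t, g2 t).
    by apply: (continuous_comp (f := fun s => (g1 s, g2 s)) cg); exact: cA.
  have cBg : B (g1 s, g2 s) @[s --> t] --> B (g1 t, g2 t).
    by apply: (continuous_comp (f := fun s => (g1 s, g2 s)) cg); exact: cB.
  by apply: cvgD; [exact: cvgM cAg cG1|exact: cvgM cBg cG2].
- by rewrite A0 B0 G1t G2t.
Qed.

End ChainRule.

(** * Circle integrals of complex-valued functions *)

Section ComplexCircleIntegral.
Context {R : realType}.
Local Notation C := R[i].
Implicit Types (X Y : R -> C) (x y c : C).

Lemma ReM x y : Re (x * y) = Re x * Re y - Im x * Im y.
Proof. by case: x y => a b [c d] /=. Qed.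

Lemma ImM x y : Im (x * y) = Re x * Im y + Im x * Re y.
Proof. by case: x y => a b [c d] /=; ring. Qed.

Lemma ReD x y : Re (x + y) = Re x + Re y.
Proof. by case: x y => a b [c d] /=. Qed.

Lemma ImD x y : Im (x + y) = Im x + Im y.
Proof. by case: x y => a b [c d] /=. Qed.

Lemma complex_ext x y : Re x = Re y -> Im x = Im y -> x = y.
Proof. by case: x y => a b [c d] /= -> ->. Qed.

Lemma normc_Re x : `|Re x| <= normc x.
Proof.
case: x => a b /=; rewrite -sqrtr_sqr ler_wsqrtr//.
by rewrite lerDl sqr_ge0.
Qed.

Lemma normc_Im x : `|Im x| <= normc x.
Proof.
case: x => a b /=; rewrite -sqrtr_sqr ler_wsqrtr//.
by rewrite lerDr sqr_ge0.
Qed.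

Lemma normc_ge0 x : 0 <= normc x.
Proof. by case: x => a b /=; exact: sqrtr_ge0. Qed.

Lemma normc_real (r : R) : normc r%:C = `|r|.
Proof. by rewrite /= expr0n addr0 sqrtr_sqr. Qed.

Lemma normcX x n : normc (x ^+ n) = normc x ^+ n.
Proof.
by elim: n => [|n IH]; rewrite ?expr0 ?normc1// !exprS normcM IH.
Qed.

Definition ccontinuous X :=
  continuous (fun r => Re (X r)) /\ continuous (fun r => Im (X r)).

Lemma ccontinuous_cst c : ccontinuous (fun=> c).
Proof. by split => r; exact: cst_continuous. Qed.

Lemma ccontinuousD X Y : ccontinuous X -> ccontinuous Y ->
  ccontinuous (fun r => X r + Y r).
Proof.
move=> [X1 X2] [Y1 Y2]; split => r.
- under eq_fun do rewrite ReD.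
  by apply: continuousD; [exact: X1|exact: Y1].
- under eq_fun do rewrite ImD.
  by apply: continuousD; [exact: X2|exact: Y2].
Qed.

Lemma ccontinuousM X Y : ccontinuous X -> ccontinuous Y ->
  ccontinuous (fun r => X r * Y r).
Proof.
move=> [X1 X2] [Y1 Y2]; split => r.
- under eq_fun do rewrite ReM.
  exact: cvgB (cvgM (X1 r) (Y1 r)) (cvgM (X2 r) (Y2 r)).
- under eq_fun do rewrite ImM.
  exact: cvgD (cvgM (X1 r) (Y2 r)) (cvgM (X2 r) (Y1 r)).
Qed.

Lemma ccontinuousX X n : ccontinuous X -> ccontinuous (fun r => X r ^+ n).
Proof.
move=> cX; elim: n => [|n IH].
  by under eq_fun do rewrite expr0; exact: ccontinuous_cst.
by under eq_fun do rewrite exprS; exact: ccontinuousM.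
Qed.

Lemma ccontinuous_sum (F : nat -> R -> C) N : (forall n, ccontinuous (F n)) ->
  ccontinuous (fun r => \sum_(n < N) F n r).
Proof.
move=> cF; elim: N => [|N IH].
  by under eq_fun do rewrite big_ord0; exact: ccontinuous_cst.
by under eq_fun do rewrite big_ord_recr /=; exact: ccontinuousD.
Qed.

Definition ccircle_int X : C :=
  circle_int (fun r => Re (X r)) +i* circle_int (fun r => Im (X r)).

Lemma ccircle_intD X Y : ccontinuous X -> ccontinuous Y ->
  ccircle_int (fun r => X r + Y r) = ccircle_int X + ccircle_int Y.
Proof.
move=> [X1 X2] [Y1 Y2]; apply: complex_ext; rewrite /= -circle_intD//.
- by under eq_fun do rewrite ReD.
- by under eq_fun do rewrite ImD.
Qed.

Lemma ccircle_intZ c X : ccontinuous X ->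
  ccircle_int (fun r => c * X r) = c * ccircle_int X.
Proof.
move=> [X1 X2].
have Z k (f : R -> R) : continuous f -> continuous (fun r => k * f r).
  by move=> cf r; apply: continuousM; [exact: cst_continuous|exact: cf].
apply: complex_ext; rewrite ?ReM ?ImM /=.
- rewrite -!circle_intZ// -mulN1r -circle_intZ; last exact: Z.
  rewrite -circle_intD; [|exact: Z|exact/Z/Z].
  by congr circle_int; apply/funext => r; rewrite ReM mulN1r.
- rewrite -!circle_intZ// -circle_intD; [|exact: Z|exact: Z].
  by congr circle_int; apply/funext => r; rewrite ImM.
Qed.

Lemma ccircle_int_cst c : ccircle_int (fun=> c) = c * (2 * pi)%:C.
Proof.
apply: complex_ext; rewrite /= circle_int_cst ?ReM ?ImM /= mulr0.
  by rewrite subr0.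
by rewrite add0r.
Qed.

Lemma ccircle_int_sum (F : nat -> R -> C) N : (forall n, ccontinuous (F n)) ->
  ccircle_int (fun r => \sum_(n < N) F n r) = \sum_(n < N) ccircle_int (F n).
Proof.
move=> cF; elim: N => [|N IH].
  rewrite big_ord0; under eq_fun do rewrite big_ord0.
  by rewrite ccircle_int_cst mul0r.
under eq_fun do rewrite big_ord_recr /=.
by rewrite ccircle_intD ?IH ?big_ord_recr//; exact: ccontinuous_sum.
Qed.

(** This is e^{-ir}, the inverse of the point at angle r: expanding 1/(w - zeta) in powers of zeta/w
    then produces non-negative powers of it. *)
Definition unit_circle (r : R) : C := cos r -i* sin r.

Lemma ccontinuous_unit_circle : ccontinuous unit_circle.
Proof.
split => r /=; first exact: continuous_cos.
by apply: continuousN; exact: continuous_sin.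
Qed.

Lemma unit_circleX n r :
  unit_circle r ^+ n = cos (n%:R * r) -i* sin (n%:R * r).
Proof.
elim: n => [|n IH]; first by rewrite expr0 mul0r cos0 sin0 oppr0.
rewrite exprS IH -natr1 mulrDl mul1r cosD sinD.
by apply: complex_ext => /=; ring.
Qed.

Lemma unit_circleJ r : (unit_circle r)^*%C * unit_circle r = 1.
Proof.
by apply: complex_ext => /=; [rewrite -(cos2Dsin2 r); ring|ring].
Qed.

Lemma normc_unit_circle r : normc (unit_circle r) = 1.
Proof. by rewrite /= sqrrN cos2Dsin2 sqrtr1. Qed.

Lemma normc_unit_circleJ r : normc (unit_circle r)^*%C = 1.
Proof. by rewrite /= opprK cos2Dsin2 sqrtr1. Qed.

Lemma sin_nat_2pi n : sin (n%:R * (2 * pi)) = 0 :> R.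
Proof.
elim: n => [|n IH]; first by rewrite mul0r sin0.
by rewrite -natr1 mulrDl mul1r [X in _ + X]mulr_natl sinD2pi.
Qed.

Lemma cos_nat_2pi n : cos (n%:R * (2 * pi)) = 1 :> R.
Proof.
elim: n => [|n IH]; first by rewrite mul0r cos0.
by rewrite -natr1 mulrDl mul1r [X in _ + X]mulr_natl cosD2pi.
Qed.

Lemma is_derive_scale (k r : R) : is_derive r 1 (fun x : R => k * x) k.
Proof.
have := is_deriveZ (f := id) k (is_derive_id r (1 : R)).
by rewrite /GRing.scale/= mulr1.
Qed.

(** The primitives sin((n+1)r)/(n+1) and cos((n+1)r)/(n+1) take the same value at 0 and 2 pi. *)
Lemma ccircle_int_unit_circleX n :
  ccircle_int (fun r => unit_circle r ^+ n.+1) = 0.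
Proof.
have [c1 c2] := ccontinuousX _ n.+1 ccontinuous_unit_circle.
have n0 : n.+1%:R != 0 :> R by rewrite pnatr_eq0.
have d r := is_derive_scale n.+1%:R r.
apply: complex_ext => /=.
- rewrite (circle_int_FTC (fun r => n.+1%:R^-1 * sin (n.+1%:R * r)) _ _ _); first 1 last.
  + exact: c1.
  + move=> r; rewrite unit_circleX /=.
    have := is_derive1_comp (is_derive_scale n.+1%:R^-1 _)
      (is_derive1_comp (is_derive_sin (n.+1%:R * r)) (d r)).
    by rewrite mulrC mulfK.
  + by rewrite sin_nat_2pi !mulr0 sin0 mulr0 subrr.
- rewrite (circle_int_FTC (fun r => n.+1%:R^-1 * cos (n.+1%:R * r)) _ _ _); first 1 last.
  + exact: c2.
  + move=> r; rewrite unit_circleX /=.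
    have := is_derive1_comp (is_derive_scale n.+1%:R^-1 _)
      (is_derive1_comp (is_derive_cos (n.+1%:R * r)) (d r)).
    by rewrite mulrC mulfK.
  + by rewrite cos_nat_2pi mulr0 cos0 mulr1 subrr.
Qed.

End ComplexCircleIntegral.

(** * Cauchy's formula and power series of holomorphic functions *)

Lemma is_derive_affine {R : realType} (f : R -> R) (x k : R) :
  (forall z, f z - f x = k * (z - x)) -> is_derive x 1 f k.
Proof.
move=> fk; apply/is_derive1_caratheodory; exists (fun=> k); split => //.
exact: cst_continuous.
Qed.

Section CauchyFormula.
Context {R : realType}.
Local Notation C := R[i].

(** The Taylor coefficient of f = u + iv at w0 = p + iq: the contour integral of f(w)/(w - w0)^{n+1}
    over the circle of radius rho, divided by 2 pi i, after the substitution w = w0 + rho e^{ir}. *)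
Definition cauchy_coef (u v : R * R -> R) (p q rho : R) (n : nat) : C :=
  ((rho^-1)%:C ^+ n) * ((2 * pi)^-1)%:C *
  ccircle_int (fun r => (u (p + rho * cos r, q + rho * sin r) +i*
                         v (p + rho * cos r, q + rho * sin r)) *
                        unit_circle r ^+ n).

Variables (u v a b : R * R -> R) (p q rho M : R).
Hypothesis rho0 : 0 < rho.
(** The factor 4 makes room for a contraction that overshoots: for l in ]-1/2, 3/2[ the coordinates
    of [P l r] stay within 3 rho of the centre. *)
Let box : set (R * R) := [set z | `|z.1 - p| < 4 * rho /\ `|z.2 - q| < 4 * rho].

(* u + i v is holomorphic on the box, with complex derivative a - i b. *)
Hypothesis du : forall z, box z ->
  is_derive (z.1 : R) 1 (fun x : R => u (x, z.2)) (a z) /\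
  is_derive (z.2 : R) 1 (fun y : R => u (z.1, y)) (b z).
Hypothesis dv : forall z, box z ->
  is_derive (z.1 : R) 1 (fun x : R => v (x, z.2)) (- b z) /\
  is_derive (z.2 : R) 1 (fun y : R => v (z.1, y)) (a z).
Hypothesis ca : forall z, box z -> {for z, continuous a}.
Hypothesis cb : forall z, box z -> {for z, continuous b}.
Hypothesis aM : forall z, box z -> `|a z| <= M.
Hypothesis bM : forall z, box z -> `|b z| <= M.

Lemma box_near z : box z -> \forall w \near z, box w.
Proof.
move=> [z1 z2].
have e0 : 0 < Num.min (4 * rho - `|z.1 - p|) (4 * rho - `|z.2 - q|).
  by rewrite lt_min !subr_gt0 z1 z2.
apply: filterS (nbhsx_ballx z _ e0) => w [].
rewrite /ball/= !lt_min => /andP[w1 _] /andP[_ w2].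
split.
- have := ler_normD (w.1 - z.1) (z.1 - p).
  by rewrite addrA subrK (distrC w.1 z.1); lra.
- have := ler_normD (w.2 - z.2) (z.2 - q).
  by rewrite addrA subrK (distrC w.2 z.2); lra.
Qed.

Let chain (f fa fb : R * R -> R) (g1 g2 : R -> R) (t d1 d2 : R) :
  (forall z, box z ->
    is_derive (z.1 : R) 1 (fun x : R => f (x, z.2)) (fa z) /\
    is_derive (z.2 : R) 1 (fun y : R => f (z.1, y)) (fb z)) ->
  (forall z, box z -> {for z, continuous fa}) ->
  (forall z, box z -> {for z, continuous fb}) ->
  box (g1 t, g2 t) ->
  is_derive t 1 g1 d1 -> is_derive t 1 g2 d2 ->
  is_derive t 1 (fun s => f (g1 s, g2 s))
    (fa (g1 t, g2 t) * d1 + fb (g1 t, g2 t) * d2).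
Proof.
move=> df cfa cfb gt g1t g2t.
apply: is_derive_chain2; [|exact: cfa|exact: cfb].
by apply: filterS (box_near _ gt) => z; exact: df.
Qed.

Variables (s t : R).
Let zeta : C := s +i* t.
Hypothesis zeta_lt : normc zeta < rho.

(* The path [P] contracts the circle of radius rho (l = 1) to the point zeta
   (l = 0), and [kernel N] truncates the geometric series of the Cauchy kernel. The
   integral of (u + i v) * kernel along [P l] varies with l only by a tail term. *)
Let ratio : C := (rho^-1)%:C * zeta.
Let kernel (N : nat) (r : R) : C := \sum_(n < N) (ratio * unit_circle r) ^+ n.
Let P1 (l r : R) : R := p + s + l * (rho * cos r - s).
Let P2 (l r : R) : R := q + t + l * (rho * sin r - t).
Let P (l r : R) := (P1 l r, P2 l r).

Let st_lt : `|s| < rho /\ `|t| < rho.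
Proof.
split; [exact: le_lt_trans (normc_Re zeta) zeta_lt|].
exact: le_lt_trans (normc_Im zeta) zeta_lt.
Qed.

(** Each coordinate is a combination of the target and a circle point with weights 1 - l and l, both
    at most 3/2 in absolute value. The open interval around [0, 1] allows differentiation in l at
    both ends. *)
Let P_box (l r : R) : - (1/2) < l < 3/2 -> box (P l r).
Proof.
move=> /andP[l1 l2]; have [s1 t1] := st_lt.
have key (x c : R) : `|x| < rho -> -1 <= c <= 1 ->
    `|x + l * (rho * c - x)| < 4 * rho.
  move=> x1 /andP[c1 c2].
  rewrite (_ : _ + _ = (1 - l) * x + l * c * rho); last by ring.
  apply: (le_lt_trans (ler_normD _ _)); rewrite !normrM (gtr0_norm rho0).
  have cc : `|c| <= 1 by rewrite ler_norml c1 c2.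
  have l1' : `|1 - l| <= 3/2 by rewrite ler_norml; lra.
  have l2' : `|l| <= 3/2 by rewrite ler_norml; lra.
  have h1 : `|1 - l| * `|x| <= 3/2 * rho by apply: ler_pM => //; exact: ltW.
  have h2 : `|l| * `|c| * rho <= 3/2 * 1 * rho.
    by rewrite ler_pM2r//; apply: ler_pM.
  by have rho0' := rho0; lra.
split => /=.
- rewrite /P1 (_ : _ - p = s + l * (rho * cos r - s)); last by ring.
  by apply: key; rewrite // cos_geN1 cos_le1.
- rewrite /P2 (_ : _ - q = t + l * (rho * sin r - t)); last by ring.
  by apply: key; rewrite // sin_geN1 sin_le1.
Qed.

Let kernel_continuous N : ccontinuous (kernel N).
Proof.
apply: (ccontinuous_sum (fun n r => (ratio * unit_circle r) ^+ n)) => n.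
apply: ccontinuousX; apply: ccontinuousM.
  exact: ccontinuous_cst.
exact: ccontinuous_unit_circle.
Qed.

(** Only the term of exponent 0 has a non-zero integral; the successor guarantees that this term is
    present. *)
Let kernel_int N : ccircle_int (kernel N.+1) = (2 * pi)%:C.
Proof.
have cE n : ccontinuous (fun r : R => unit_circle r ^+ n).
  exact/ccontinuousX/ccontinuous_unit_circle.
have -> : kernel N.+1 =
    (fun r => \sum_(n < N.+1) ratio ^+ n * unit_circle r ^+ n).
  by apply/funext => r; apply: eq_bigr => n _; rewrite exprMn.
rewrite (ccircle_int_sum (fun n r => ratio ^+ n * unit_circle r ^+ n)); last first.
  by move=> n; apply: ccontinuousM; [exact: ccontinuous_cst|exact: cE].
rewrite big_ord_recl big1 => [|i _].
  rewrite addr0 expr0; under eq_fun do rewrite expr0 mul1r.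
  by rewrite ccircle_int_cst mul1r.
by rewrite ccircle_intZ// ccircle_int_unit_circleX mulr0.
Qed.

(** The first factor is the velocity of the path in l, and equals rho e^{ir} (1 - q) with q =
    [ratio * unit_circle r], the ratio of the geometric sum; so the product telescopes. *)
Let kernelE N r : ((rho * cos r - s) +i* (rho * sin r - t)) * kernel N r =
  rho%:C * (unit_circle r)^*%C * (1 - (ratio * unit_circle r) ^+ N).
Proof.
have -> : (rho * cos r - s) +i* (rho * sin r - t) =
    rho%:C * (unit_circle r)^*%C * (1 - ratio * unit_circle r).
  rewrite mulrBr mulr1 (mulrC ratio) mulrA -(mulrA rho%:C) unit_circleJ mulr1.
  rewrite /ratio mulrA -rmorphM/= divff ?gt_eqF// mul1r.
  by apply: complex_ext => /=; ring.
by rewrite -mulrA /kernel -[X in _ * X = _]opprK -mulNr opprB -subrX1 opprB.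
Qed.


Let dP1r (l r : R) : is_derive r 1 (P1 l) (l * (rho * - sin r)).
Proof.
have dA : is_derive (cos r) 1 (fun x : R => p + s + l * (rho * x - s)) (l * rho).
  by apply: is_derive_affine => z; ring.
by rewrite mulrA; exact: is_derive1_comp dA (is_derive_cos r).
Qed.

Let dP2r (l r : R) : is_derive r 1 (P2 l) (l * (rho * cos r)).
Proof.
have dA : is_derive (sin r) 1 (fun x : R => q + t + l * (rho * x - t)) (l * rho).
  by apply: is_derive_affine => z; ring.
by rewrite mulrA; exact: is_derive1_comp dA (is_derive_sin r).
Qed.

Let dP1l (l r : R) : is_derive l 1 (P1^~ r) (rho * cos r - s).
Proof. by apply: is_derive_affine => z; rewrite /P1; ring. Qed.

Let dP2l (l r : R) : is_derive l 1 (P2^~ r) (rho * sin r - t).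
Proof. by apply: is_derive_affine => z; rewrite /P2; ring. Qed.

Let P_continuous l : continuous (P l).
Proof.
move=> r; apply: cvg_pair_nbhs.
  exact: is_derive_continuous (dP1r l r).
exact: is_derive_continuous (dP2r l r).
Qed.

Let comp_P_continuous (f : R * R -> R) l : - (1/2) < l < 3/2 ->
  (forall z, box z -> {for z, continuous f}) -> continuous (fun r => f (P l r)).
Proof.
move=> lI cf r; apply: (continuous_comp (f := P l)); first exact: P_continuous.
exact/cf/P_box.
Qed.

Let box_continuous (f fa fb : R * R -> R) :
  (forall z, box z ->
    is_derive (z.1 : R) 1 (fun x : R => f (x, z.2)) (fa z) /\
    is_derive (z.2 : R) 1 (fun y : R => f (z.1, y)) (fb z)) ->
  (forall z, box z -> {for z, continuous fa}) ->
  (forall z, box z -> {for z, continuous fb}) ->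
  forall l, - (1/2) < l < 3/2 -> continuous (fun r => f (P l r)).
Proof.
move=> df cfa cfb l lI r.
have := @chain f fa fb (P1 l) (P2 l) r _ _ df cfa cfb (P_box l r lI) (dP1r l r) (dP2r l r).
by move/is_derive_continuous.
Qed.

Let cNb z : box z -> {for z, continuous (fun z => - b z)}.
Proof. by move=> bz; apply: cvgN; exact: cb. Qed.

(** The real part of (u + iv)(P l r) times the kernel. The imaginary part is recovered later by
    applying the result to -i(u + iv) = v - iu. *)
Let psi N l r :=
  u (P l r) * Re (kernel N r) - v (P l r) * Im (kernel N r).
Let dpsi N l r :=
  (a (P l r) * (rho * cos r - s) + b (P l r) * (rho * sin r - t)) *
    Re (kernel N r) -
  (- b (P l r) * (rho * cos r - s) + a (P l r) * (rho * sin r - t)) *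
    Im (kernel N r).

Let psi_is_derive N (l r : R) : - (1/2) < l < 3/2 ->
  is_derive l 1 (psi N ^~ r) (dpsi N l r).
Proof.
move=> lI.
have d1 := @chain u a b (P1^~ r) (P2^~ r) l _ _ du ca cb (P_box l r lI) (dP1l l r) (dP2l l r).
have d2 := @chain v _ a (P1^~ r) (P2^~ r) l _ _ dv cNb ca (P_box l r lI) (dP1l l r) (dP2l l r).
have := is_deriveB (is_deriveM d1 (is_derive_cst (Re (kernel N r)) l 1))
  (is_deriveM d2 (is_derive_cst (Im (kernel N r)) l 1)).
move/is_derive_eq; apply.
by rewrite !scaler0 !add0r /dpsi /GRing.scale/=; ring.
Qed.

Let psi_continuous N l : - (1/2) < l < 3/2 -> continuous (psi N l).
Proof.
move=> lI r; have [k1 k2] := kernel_continuous N.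
exact: cvgB (cvgM (box_continuous _ _ _ du ca cb _ lI r) (k1 r))
            (cvgM (box_continuous _ _ _ dv cNb ca _ lI r) (k2 r)).
Qed.

Let tail N (r : R) : C :=
  rho%:C * (unit_circle r)^*%C * (ratio * unit_circle r) ^+ N.

Let tail_norm N r : normc (tail N r) = rho * normc ratio ^+ N.
Proof.
rewrite /tail normcM [X in X * _]normcM normcX (normcM ratio).
rewrite normc_real normc_unit_circleJ normc_unit_circle !mulr1 gtr0_norm //.
Qed.

(** With f' = a - ib, [radial] and [rest] are the real parts of f'(P) rho e^{ir} and of f'(P) times
    [tail]. *)
Let radial l r := a (P l r) * (rho * cos r) + b (P l r) * (rho * sin r).
Let rest N l r := a (P l r) * Re (tail N r) + b (P l r) * Im (tail N r).

(** [dpsi] is the real part of f'(P) times velocity times kernel, and [kernelE] evaluates the last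
    two factors. The first summand integrates to 0 over the circle; the second is of order
    (|zeta|/rho)^N. *)
Let dpsiE N l r : dpsi N l r = radial l r - rest N l r.
Proof.
have := kernelE N r; rewrite mulrBr mulr1 -/(tail N r) /dpsi /radial /rest.
case: (kernel N r) => k1 k2 H.
have H1 := congr1 Re H; have H2 := congr1 Im H; move: H1 H2.
case: (tail N r) => t1 t2 /= H1 H2.
have -> : t1 = rho * cos r - ((rho * cos r - s) * k1 - (rho * sin r - t) * k2).
  by rewrite H1; ring.
have -> : t2 = rho * sin r - ((rho * cos r - s) * k2 + (rho * sin r - t) * k1).
  by rewrite H2; ring.
ring.
Qed.

Let radial_continuous l : - (1/2) < l < 3/2 -> continuous (radial l).
Proof.
move=> lI r.
have cc : (fun r => rho * cos r) x @[x --> r] --> rho * cos r.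
  by apply: cvgM; [exact: cvg_cst|exact: continuous_cos].
have cs : (fun r => rho * sin r) x @[x --> r] --> rho * sin r.
  by apply: cvgM; [exact: cvg_cst|exact: continuous_sin].
exact: cvgD (cvgM (comp_P_continuous _ _ lI ca r) cc)
  (cvgM (comp_P_continuous _ _ lI cb r) cs).
Qed.

Let rest_continuous N l : - (1/2) < l < 3/2 -> continuous (rest N l).
Proof.
move=> lI r.
have [c1 c2] : ccontinuous (tail N).
  apply: ccontinuousM; last first.
    apply/ccontinuousX/ccontinuousM; first exact: ccontinuous_cst.
    exact: ccontinuous_unit_circle.
  apply: ccontinuousM; first exact: ccontinuous_cst.
  split => x /=; first exact: continuous_cos.
  by apply: cvgN; apply: cvgN; exact: continuous_sin.
exact: cvgD (cvgM (comp_P_continuous _ _ lI ca r) (c1 r))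
  (cvgM (comp_P_continuous _ _ lI cb r) (c2 r)).
Qed.

(* The derivative of [v] along the circle is [l] times [radial l]. *)
Let radial_int l : 0 < l < 3/2 -> circle_int (radial l) = 0.
Proof.
move=> /andP[l0 l1].
have lI : - (1/2) < l < 3/2 by rewrite l1 andbT; lra.
(* Cancelling [l] requires l > 0; the mean value theorem on [0, 1] will supply an interior point. *)
suff H : l * circle_int (radial l) = 0.
  by move/eqP : H; rewrite mulf_eq0 gt_eqF//= => /eqP.
rewrite -circle_intZ; last exact: radial_continuous.
rewrite (circle_int_FTC (fun r => v (P l r)) _ _ _); first 1 last.
- move=> r; apply: cvgM; first exact: cvg_cst.
  exact: radial_continuous.
- move=> r; have := @chain v _ a (P1 l) (P2 l) r _ _ dv cNb ca (P_box l r lI)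
    (dP1r l r) (dP2r l r).
  by move/is_derive_eq; apply; rewrite /radial; ring.
have c2 : cos (2 * pi) = 1 :> R by rewrite -[X in cos X]mul1r (cos_nat_2pi 1).
have s2 : sin (2 * pi) = 0 :> R by rewrite -[X in sin X]mul1r (sin_nat_2pi 1).
by rewrite /P /P1 /P2 c2 s2 cos0 sin0 subrr.
Qed.

Let psi_int N (l : R) := circle_int (psi N l).

Let rest_le N l r : - (1/2) < l < 3/2 ->
  `|rest N l r| <= 2 * M * rho * normc ratio ^+ N.
Proof.
move=> lI; have bP := P_box l r lI.
apply: (le_trans (ler_normD _ _)); rewrite !normrM.
have h1 : `|a (P l r)| * `|Re (tail N r)| <= M * (rho * normc ratio ^+ N).
  by rewrite -(tail_norm N r); apply: ler_pM => //; [exact: aM|exact: normc_Re].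
have h2 : `|b (P l r)| * `|Im (tail N r)| <= M * (rho * normc ratio ^+ N).
  by rewrite -(tail_norm N r); apply: ler_pM => //; [exact: bM|exact: normc_Im].
by apply: (le_trans (lerD h1 h2)); rewrite le_eqVlt; apply/orP; left; apply/eqP; ring.
Qed.

Let radial_le (l r : R) : - (1/2) < l < 3/2 -> `|radial l r| <= 2 * M * rho.
Proof.
move=> lI; have bP := P_box l r lI.
apply: (le_trans (ler_normD _ _)); rewrite !normrM (gtr0_norm rho0).
have c1 : `|cos r| <= 1 by rewrite ler_norml cos_geN1 cos_le1.
have s1 : `|sin r| <= 1 by rewrite ler_norml sin_geN1 sin_le1.
have h1 : `|a (P l r)| * (rho * `|cos r|) <= M * rho.
  apply: ler_pM => //; first by rewrite mulr_ge0// ltW.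
    exact: aM.
  by rewrite -[leRHS]mulr1 ler_pM2l.
have h2 : `|b (P l r)| * (rho * `|sin r|) <= M * rho.
  apply: ler_pM => //; first by rewrite mulr_ge0// ltW.
    exact: bM.
  by rewrite -[leRHS]mulr1 ler_pM2l.
by apply: (le_trans (lerD h1 h2)); rewrite le_eqVlt; apply/orP; left; apply/eqP; ring.
Qed.

Let psi_int_is_derive N (l : R) : - (1/2) < l < 3/2 ->
  is_derive l 1 (psi_int N) (circle_int (dpsi N l)).
Proof.
move=> lI.
apply: (circle_int_is_derive (psi N) (dpsi N) l (- (1/2)) (3/2)
  (2 * M * rho + 2 * M * rho * normc ratio ^+ N)) => //.
- by move=> x xI; exact: psi_continuous.
- by move=> x y xI; exact: psi_is_derive.
- move=> x y xI; rewrite dpsiE; apply: (le_trans (ler_normB _ _)).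
  by apply: lerD; [exact: radial_le|exact: rest_le].
Qed.

Let dpsi_int_le N l : 0 < l < 1 ->
  `|circle_int (dpsi N l)| <= 2 * M * rho * normc ratio ^+ N * (2 * pi).
Proof.
move=> /andP[l0 l1].
have lI : - (1/2) < l < 3/2 by lra.
have -> : dpsi N l = (fun r => radial l r + (- 1) * rest N l r).
  by apply/funext => r; rewrite dpsiE mulN1r.
rewrite circle_intD; first 1 last.
- exact: radial_continuous.
- by move=> r; apply: cvgM; [exact: cvg_cst|exact: rest_continuous].
rewrite radial_int ?add0r; last by lra.
rewrite circle_intZ; last exact: rest_continuous.
rewrite mulN1r normrN.
apply: circle_int_norm_le; first exact: rest_continuous.
by move=> r; exact: rest_le.
Qed.

Let psi_int_diff N :
  `|psi_int N 1 - psi_int N 0| <= 2 * M * rho * normc ratio ^+ N * (2 * pi).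
Proof.
have d (l : R) : l \in `]0, 1[ -> is_derive l 1 (psi_int N) (circle_int (dpsi N l)).
  by rewrite in_itv/= => /andP[l0 l1]; apply: psi_int_is_derive; lra.
have c : {within `[0, 1], continuous (psi_int N)}.
  apply: derivable_within_continuous => l; rewrite in_itv/= => /andP[l0 l1].
  have lI : - (1/2) < l < 3/2 by lra.
  by have [] := psi_int_is_derive N l lI.
have [l l01 ->] := MVT ltr01 d c.
rewrite subr0 mulr1; apply: dpsi_int_le.
by move: l01; rewrite in_itv.
Qed.

(** For l = 0 the path stays at the evaluation point, and only the integral of the kernel is
    left. *)
Let psi_int0 N : psi_int N.+1 0 = u (p + s, q + t) * (2 * pi).
Proof.
have [k1 k2] := kernel_continuous N.+1.
have kI := kernel_int N.
rewrite /psi_int.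
have -> : psi N.+1 0 = fun r => u (p + s, q + t) * Re (kernel N.+1 r) +
    - v (p + s, q + t) * Im (kernel N.+1 r).
  by apply/funext => r; rewrite /psi /P /P1 /P2 !mul0r !addr0 mulNr.
have Z k (f : R -> R) : continuous f -> continuous (fun r => k * f r).
  by move=> cf r; apply: cvgM; [exact: cvg_cst|exact: cf].
rewrite circle_intD; [|exact: Z|exact: Z].
rewrite circle_intZ// circle_intZ//.
have -> : circle_int (fun r => Re (kernel N.+1 r)) = 2 * pi.
  by have := congr1 Re kI.
have -> : circle_int (fun r => Im (kernel N.+1 r)) = 0.
  by have := congr1 Im kI.
by rewrite mulr0 addr0.
Qed.

(** For l = 1 the path is the circle, and each power in the kernel contributes one term of the
    Taylor polynomial. *)
Let psi_int1 N : psi_int N 1 =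
  Re (\sum_(n < N) cauchy_coef u v p q rho n * zeta ^+ n) * (2 * pi).
Proof.
have lI : - (1/2) < (1 : R) < 3/2 by lra.
pose U r : C := u (P 1 r) +i* v (P 1 r).
have UE : U = fun r => u (p + rho * cos r, q + rho * sin r) +i*
                       v (p + rho * cos r, q + rho * sin r).
  apply/funext => r; rewrite /U /P /P1 /P2 !mul1r.
  by congr (u (_, _) +i* v (_, _)); ring.
have cU : ccontinuous U.
  by split; [exact: (box_continuous _ _ _ du ca cb)|exact: (box_continuous _ _ _ dv cNb ca)].
have cE n : ccontinuous (fun r => U r * unit_circle r ^+ n).
  exact/ccontinuousM/ccontinuousX/ccontinuous_unit_circle.
have -> : psi_int N 1 = Re (ccircle_int (fun r => U r * kernel N r)).
  by rewrite /= /psi_int; congr circle_int; apply/funext => r; rewrite ReM.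
have -> : (fun r => U r * kernel N r) =
    (fun r => \sum_(n < N) ratio ^+ n * (U r * unit_circle r ^+ n)).
  apply/funext => r; rewrite /kernel mulr_sumr; apply: eq_bigr => n _.
  by rewrite exprMn mulrCA.
rewrite (ccircle_int_sum (fun n r => ratio ^+ n * (U r * unit_circle r ^+ n))); last first.
  by move=> n; apply: ccontinuousM; [exact: ccontinuous_cst|exact: cE].
have -> : \sum_(n < N) ccircle_int (fun r => ratio ^+ n * (U r * unit_circle r ^+ n)) =
    (2 * pi)%:C * \sum_(n < N) cauchy_coef u v p q rho n * zeta ^+ n.
  rewrite mulr_sumr; apply: eq_bigr => n _.
  have -> : cauchy_coef u v p q rho n = (rho^-1)%:C ^+ n * ((2 * pi)^-1)%:C *
      ccircle_int (fun r => U r * unit_circle r ^+ n) by rewrite UE.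
  rewrite ccircle_intZ// /ratio exprMn.
  have pi0 : (2 * pi)%:C * ((2 * pi)^-1)%:C = 1 :> C.
    by rewrite -rmorphM/= divff// gt_eqF// pi2_gt0.
  rewrite -[LHS]mul1r -pi0; ring.
by rewrite ReM /= mul0r subr0 mulrC.
Qed.

Lemma cauchy_partial_sum N :
  `|Re (\sum_(n < N.+1) cauchy_coef u v p q rho n * zeta ^+ n) - u (p + s, q + t)|
  <= 2 * M * rho * (normc zeta / rho) ^+ N.+1.
Proof.
have := psi_int_diff N.+1; rewrite psi_int0 psi_int1 -mulrBl normrM.
rewrite (gtr0_norm pi2_gt0) ler_pM2r ?pi2_gt0//.
have rV0 : 0 < rho^-1 by rewrite invr_gt0.
by rewrite normcM normc_real (gtr0_norm rV0) (mulrC rho^-1).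
Qed.

End CauchyFormula.

Section HolomorphicSeries.
Context {R : realType}.
Local Notation C := R[i].

(** The pair (v, -u) represents -i(u + iv), and the coefficients are complex linear in the
    function. *)
Lemma cauchy_coefN (u v : R * R -> R) (p q rho : R) n :
  (forall r : R, {for (p + rho * cos r, q + rho * sin r), continuous u}) ->
  (forall r : R, {for (p + rho * cos r, q + rho * sin r), continuous v}) ->
  cauchy_coef v (fun z => - u z) p q rho n = - 'i * cauchy_coef u v p q rho n.
Proof.
move=> cu cv; rewrite /cauchy_coef.
have cP : continuous (fun r : R => (p + rho * cos r, q + rho * sin r)).
  move=> r; apply: cvg_pair_nbhs; apply: cvgD; try exact: cvg_cst.
    by apply: cvgM; [exact: cvg_cst|exact: continuous_cos].
  by apply: cvgM; [exact: cvg_cst|exact: continuous_sin].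
have cU : ccontinuous (fun r => (u (p + rho * cos r, q + rho * sin r) +i*
    v (p + rho * cos r, q + rho * sin r)) * unit_circle r ^+ n).
  apply: ccontinuousM; last exact/ccontinuousX/ccontinuous_unit_circle.
  split => r /=.
    by apply: (continuous_comp (f := fun r : R => (p + rho * cos r, q + rho * sin r)));
      [exact: cP|exact: cu].
  by apply: (continuous_comp (f := fun r : R => (p + rho * cos r, q + rho * sin r)));
    [exact: cP|exact: cv].
rewrite mulrCA -(ccircle_intZ (- 'i) _ cU); congr (_ * ccircle_int _).
apply/funext => r; rewrite mulrA; congr (_ * _).
by apply: complex_ext => /=; ring.
Qed.

Lemma holomorphic_series (u v a b : R * R -> R) (p q rho M : R) :
  let box := [set z : R * R | `|z.1 - p| < 4 * rho /\ `|z.2 - q| < 4 * rho] in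
  0 < rho ->
  (forall z, box z ->
    is_derive (z.1 : R) 1 (fun x : R => u (x, z.2)) (a z) /\
    is_derive (z.2 : R) 1 (fun y : R => u (z.1, y)) (b z)) ->
  (forall z, box z ->
    is_derive (z.1 : R) 1 (fun x : R => v (x, z.2)) (- b z) /\
    is_derive (z.2 : R) 1 (fun y : R => v (z.1, y)) (a z)) ->
  (forall z, box z -> {for z, continuous a}) ->
  (forall z, box z -> {for z, continuous b}) ->
  (forall z, box z -> `|a z| <= M) -> (forall z, box z -> `|b z| <= M) ->
  exists alpha : nat -> C, forall zeta : C, normc zeta < rho ->
    series (fun n => Re (alpha n * zeta ^+ n)) @ \oo -->
      u (p + Re zeta, q + Im zeta) /\
    series (fun n => Im (alpha n * zeta ^+ n)) @ \oo -->
      v (p + Re zeta, q + Im zeta).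
Proof.
move=> box rho0 du dv ca cb aM bM.
exists (cauchy_coef u v p q rho) => zeta zrho.
have to_lim (f : nat -> C) (l : R) :
    (forall N, `|Re (\sum_(n < N.+1) f n) - l| <=
       2 * M * rho * (normc zeta / rho) ^+ N.+1) ->
    series (fun n => Re (f n)) @ \oo --> l.
  move=> fl.
  have h0 : (2 * M * rho) *: (normc zeta / rho) ^+ N @[N --> \oo] --> (0 : R).
    rewrite -[X in _ --> X](scaler0 _ (2 * M * rho)); apply: cvgZr; apply: cvg_expr.
    rewrite ger0_norm ?divr_ge0 ?normc_ge0 ?(ltW rho0)//.
    by rewrite ltr_pdivrMr// mul1r.
  apply/cvgrPdist_le => eps eps0.
  move/cvgrPdist_le : h0 => /(_ _ eps0) [N _ hN].
  exists N.+1 => // m /= Nm.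
  have -> : series (fun n => Re (f n)) m = Re (\sum_(n < m) f n).
    rewrite /series/= big_mkord; elim: {Nm}m => [|m IH]; first by rewrite !big_ord0.
    by rewrite !big_ord_recr /= IH; case: (\sum_(_ < _) _) => ? ?; case: (f m).
  case: m Nm => // m Nm; rewrite distrC; apply: le_trans (fl m) _.
  have := hN m.+1 (leqW Nm); rewrite sub0r normrN; apply: le_trans.
  exact: ler_norm.
split.
  apply: to_lim => N.
  have := cauchy_partial_sum u v a b p q rho M rho0 du dv ca cb aM bM (Re zeta) (Im zeta).
  by case: zeta zrho => s t zrho; exact.
have box_circle (r : R) : box (p + rho * cos r, q + rho * sin r).
  rewrite /box/=; have -> : p + rho * cos r - p = rho * cos r by ring.
  have -> : q + rho * sin r - q = rho * sin r by ring.
  rewrite !normrM (gtr0_norm rho0).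
  have c1 : `|cos r| <= 1 by rewrite ler_norml cos_geN1 cos_le1.
  have s1 : `|sin r| <= 1 by rewrite ler_norml sin_geN1 sin_le1.
  have h1 : rho * `|cos r| <= rho * 1 by rewrite ler_pM2l.
  have h2 : rho * `|sin r| <= rho * 1 by rewrite ler_pM2l.
  by split; lra.
(* Existence of partial derivatives alone would not give continuity; their own continuity does,
   through the factorization of [caratheodory2]. *)
have box_cont (f fa fb : R * R -> R) :
    (forall z, box z ->
      is_derive (z.1 : R) 1 (fun x : R => f (x, z.2)) (fa z) /\
      is_derive (z.2 : R) 1 (fun y : R => f (z.1, y)) (fb z)) ->
    (forall z, box z -> {for z, continuous fa}) ->
    (forall z, box z -> {for z, continuous fb}) ->
    forall z, box z -> {for z, continuous f}.
  move=> df cfa cfb z bz.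
  have dn : \forall w \near z,
      is_derive (w.1 : R) 1 (fun x : R => f (x, w.2)) (fa w) /\
      is_derive (w.2 : R) 1 (fun y : R => f (w.1, y)) (fb w).
    by apply: filterS (box_near p q rho z bz) => w; exact: df.
  have [A [B [fE cA cB _ _]]] := caratheodory2 f fa fb z dn (cfa z bz) (cfb z bz).
  have -> : f = fun w => f z + (A w * (w.1 - z.1) + B w * (w.2 - z.2)).
    by apply/funext => w; rewrite -fE addrC subrK.
  apply: cvgD; first exact: cvg_cst.
  have c1 : w.1 - z.1 @[w --> z] --> z.1 - z.1.
    by apply: cvgB; [exact: cvg_fst|exact: cvg_cst].
  have c2 : w.2 - z.2 @[w --> z] --> z.2 - z.2.
    by apply: cvgB; [exact: cvg_snd|exact: cvg_cst].
  exact: cvgD (cvgM cA c1) (cvgM cB c2).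
have cNa z : box z -> {for z, continuous (fun z => - a z)}.
  by move=> bz; apply: cvgN; exact: ca.
have cNb z : box z -> {for z, continuous (fun z => - b z)}.
  by move=> bz; apply: cvgN; exact: cb.
have cu := box_cont _ _ _ du ca cb.
have cv := box_cont _ _ _ dv cNb ca.
have du' z : box z ->
    is_derive (z.1 : R) 1 (fun x : R => - u (x, z.2)) (- a z) /\
    is_derive (z.2 : R) 1 (fun y : R => - u (z.1, y)) (- b z).
  by move=> /du[d1 d2]; split; [exact: is_deriveN d1|exact: is_deriveN d2].
have H := cauchy_partial_sum v (fun z => - u z) (fun z => - b z) a p q rho M
  rho0 dv du' cNb ca _ aM.
have bM' z : box z -> `|- b z| <= M by rewrite normrN; exact: bM.
(* Im c = Re(-ic), so the claim for [v] is the claim for the real part of -i(u + iv). *)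
have -> : (fun n => Im (cauchy_coef u v p q rho n * zeta ^+ n)) =
    fun n => Re (cauchy_coef v (fun z => - u z) p q rho n * zeta ^+ n).
  apply/funext => n; rewrite cauchy_coefN.
  - rewrite -[- 'i * _ * _]mulrA; move: (cauchy_coef u v p q rho n * _) => [x y].
    by rewrite ReM /=; ring.
  - by move=> r; exact: cu.
  - by move=> r; exact: cv.
apply: to_lim => N.
have := H bM' (Re zeta) (Im zeta).
by case: zeta zrho => s t zrho; exact.
Qed.

End HolomorphicSeries.

(** * Finite-dimensional normed spaces *)

Lemma cvg_sum_ord {R : numFieldType} {V : normedModType R} {T : Type}
    (F : set_system T) {FF : Filter F} n (f : 'I_n -> T -> V) (a : 'I_n -> V) :
  (forall i, f i x @[x --> F] --> a i) ->
  \sum_(i < n) f i x @[x --> F] --> \sum_(i < n) a i.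
Proof.
elim: n f a => [|n IH] f a fa.
  by rewrite big_ord0; under eq_cvg do rewrite big_ord0; exact: cvg_cst.
rewrite big_ord_recl; under eq_cvg do rewrite big_ord_recl.
by apply: cvgD; [exact: fa|exact: IH].
Qed.

Section FiniteDimension.
Context {R : realType} {A : normedModType R}.

(** A spanning family of least length is free: a relation with c_j non-zero would express e_j
    through the others, and dropping e_j would leave a shorter spanning family. *)
Lemma free_spanning_family : finite_dimensional A ->
  exists n (e : 'I_n -> A),
    (forall x, exists c : 'I_n -> R, x = \sum_(i < n) c i *: e i) /\
    (forall c : 'I_n -> R, \sum_(i < n) c i *: e i = 0 -> forall i, c i = 0).
Proof.
move=> fin_dim.
pose P n := `[< exists e : 'I_n -> A,
  forall x, exists c : 'I_n -> R, x = \sum_(i < n) c i *: e i >].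
have exP : exists n, P n by have [n H] := fin_dim; exists n; apply/asboolP.
case: (ex_minnP exP) => n /asboolP[e se] nmin; exists n, e; split=> // c c0 j.
apply/eqP; apply: contrapT => /negP cj0.
have : P n.-1.
  apply/asboolP; exists (e \o lift j) => x; have [d ->] := se x.
  exists (fun i => d (lift j i) - d j / c j * c (lift j i)).
  have /(congr1 (fun y => (d j / c j) *: y)) := c0.
  rewrite scaler0 (bigD1_ord (op := GRing.add) j)//= scalerDr scalerA divfK//.
  move=> /eqP; rewrite addr_eq0 => /eqP djE.
  rewrite (bigD1_ord (op := GRing.add) j)//= djE scaler_sumr addrC -sumrB.
  by apply: eq_bigr => i _; rewrite scalerBl scalerA.
have : (n.-1 < n)%N by rewrite ltn_predL (leq_ltn_trans _ (ltn_ord j)).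
by rewrite ltnNge => /negP nn /nmin.
Qed.

(** By compactness of the unit sphere of R^n, the norm of a combination of the e_i attains a minimum
    there, positive since the family is free; its inverse bounds all coordinates. *)
Lemma bounded_coordinates : finite_dimensional A ->
  exists n (e : 'I_n -> A) (l : 'I_n -> A -> R) (K : R),
    [/\ forall i a x y, l i (a *: x + y) = a * l i x + l i y,
        forall i x, `|l i x| <= K * `|x| &
        forall x, x = \sum_(i < n) l i x *: e i].
Proof.
move=> /free_spanning_family[n [e [se fe]]].
have /choice[l lE] := se.
have uniq (c d : 'I_n -> R) : \sum_(i < n) c i *: e i = \sum_(i < n) d i *: e i ->
    forall i, c i = d i.
  move=> cd i; apply/eqP; rewrite -subr_eq0; apply/eqP.
  apply: (fe (fun i => c i - d i)); under eq_bigr do rewrite scalerBl.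
  by rewrite sumrB cd subrr.
exists n, e, (fun i x => l x i).
have llin i a x y : l (a *: x + y) i = a * l x i + l y i.
  move: i; apply: uniq; rewrite -lE.
  under eq_bigr do rewrite scalerDl -scalerA.
  by rewrite big_split/= -scaler_sumr -!lE.
pose T (v : 'rV[R]_n) : A := \sum_(i < n) v 0 i *: e i.
have cT : continuous (fun v => `|T v|).
  move=> v; have cTv : T w @[w --> v] --> T v.
    apply: (cvg_sum_ord (nbhs v) n (fun i (w : 'rV[R]_n) => w 0 i *: e i)) => i.
    by apply: cvgZr_tmp; exact: coord_continuous.
  exact: cvg_norm cTv.
pose S := [set v : 'rV[R]_n | `|v| = 1].
have cS : compact S.
  apply: bounded_closed_compact.
    exists 1; split; first exact: num_real.
    by move=> x x1 v /= ->; exact: ltW.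
  apply: (@closed_comp _ _ (fun v : 'rV[R]_n => `|v|) [set x | x = 1]).
    by move=> v _; exact: norm_continuous.
  exact: closed_eq.
have lrow x i : `|l x i| <= `|\row_j l x j|.
  have := @mx_normrE R 1 n (\row_j l x j).
  rewrite [leRHS]/Num.norm/= => ->.
  by apply/bigmax_geP; right; exists (ord0, i) => //=; rewrite mxE.
have Tl x : T (\row_j l x j) = x.
  by rewrite [RHS]lE; apply: eq_bigr => i _; rewrite mxE.
have TZ a v : T (a *: v) = a *: T v.
  by rewrite /T scaler_sumr; apply: eq_bigr => i _; rewrite mxE scalerA.
(* In dimension 0 the sphere is empty and there is no minimum to take; every coordinate row is then
   0. *)
have [S0|/set0P S0] := eqVneq S set0.
  exists 0; split => // i x; rewrite mul0r.
  have [z|nz] := eqVneq (\row_j l x j) 0.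
    by apply: le_trans (lrow x i) _; rewrite z normr0.
  suff : S (`|\row_j l x j|^-1 *: (\row_j l x j)) by rewrite S0.
  by rewrite /S/= normrZ normfV normr_id mulVf// normr_eq0.
have [c cS1 cmin] := compact_EVT_min S0 cS (continuous_subspaceT cT).
have c0 : 0 < `|T c|.
  rewrite normr_gt0; apply/eqP => Tc0.
  move: cS1; rewrite inE /S/= => c1.
  suff : c = 0 by move=> c0; move: c1; rewrite c0 normr0 => /esym/eqP; rewrite oner_eq0.
  apply/matrixP => i j; rewrite ord1 [RHS]mxE.
  exact: (fe (fun j => c 0 j) Tc0 j).
exists `|T c|^-1; split => // i x.
apply: (le_trans (lrow x i)).
have [->|nz] := eqVneq (\row_j l x j) 0.
  by rewrite normr0 mulr_ge0// invr_ge0.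
have nz0 : 0 < `|\row_j l x j| by rewrite normr_gt0.
rewrite mulrC ler_pdivlMr// mulrC -ler_pdivlMr// mulrC.
have := cmin (`|\row_j l x j|^-1 *: (\row_j l x j)).
rewrite TZ Tl normrZ normfV normr_id; apply.
by rewrite inE /S/= normrZ normfV normr_id mulVf// normr_eq0.
Qed.

Lemma linear_bounded (V : normedModType R) (L : A -> V) : finite_dimensional A ->
  linear L -> exists2 K : R, 0 < K & forall x, `|L x| <= K * `|x|.
Proof.
move=> /bounded_coordinates[n [e [l [K [llin lK lE]]]]] linL.
have L0 : L 0 = 0.
  by have := linL (-1) 0 0; rewrite scaler0 addr0 scaleN1r addNr.
have Lsum m (c : 'I_m -> R) (d : 'I_m -> A) :
    L (\sum_(i < m) c i *: d i) = \sum_(i < m) c i *: L (d i).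
  elim: m c d => [|m IH] c d; first by rewrite !big_ord0.
  by rewrite !big_ord_recl linL IH.
(* The summand 1 makes the constant positive, so that epsilons can be divided by it. *)
exists (1 + \sum_(i < n) `|K| * `|L (e i)|).
  by rewrite ltr_pwDl// sumr_ge0// => i _; rewrite mulr_ge0.
move=> x; rewrite {1}(lE x) Lsum (le_trans (ler_norm_sum _ _ _))//.
rewrite mulrDl mul1r; apply: ler_wpDl => //.
rewrite mulr_suml; apply: ler_sum => i _; rewrite normrZ mulrAC.
rewrite ler_wpM2r//; apply: le_trans (lK i x) _.
by rewrite ler_wpM2r// ler_norm.
Qed.

Lemma linear_cvg (V : normedModType R) (L : A -> V) : finite_dimensional A ->
  linear L -> forall (T : Type) (F : set_system T) (FF : Filter F) (f : T -> A) (a : A),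
  f x @[x --> F] --> a -> L (f x) @[x --> F] --> L a.
Proof.
move=> fd linL T F FF f a fa.
have [K K0 LK] := linear_bounded V L fd linL.
have LB x y : L x - L y = L (x - y).
  by have := linL (-1) y x; rewrite !scaleN1r (addrC (- y)) => ->; rewrite addrC.
apply/cvgrPdist_lt => eps eps0.
have eK : 0 < eps / K by rewrite divr_gt0.
move/cvgrPdist_lt : fa => /(_ _ eK); apply: filterS => x.
by rewrite ltr_pdivlMr// LB mulrC; apply: le_lt_trans; exact: LK.
Qed.

End FiniteDimension.

(** * Series and differentials *)

Section SeriesBounds.
Context {R : realType}.

Lemma series_tail_le {V : normedModType R} (u : nat -> V) (l : V) m (B : R) :
  series u @ \oo --> l -> (forall N, \sum_(m <= n < N) `|u n| <= B) ->
  `|l - \sum_(0 <= n < m) u n| <= B.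
Proof.
move=> ul uB.
have cl : `|series u N - \sum_(0 <= n < m) u n| @[N --> \oo] -->
    `|l - \sum_(0 <= n < m) u n|.
  by apply: cvg_norm; apply: cvgB; [exact: ul|exact: cvg_cst].
apply: (cvgr_to_le cl); exists m => // N /= mN.
rewrite /series/= (big_cat_nat (leq0n m) mN)/= addrAC subrr add0r.
exact: le_trans (ler_norm_sum _ _ _) (uB N).
Qed.

Lemma sum_nat_half_le m N : \sum_(m <= n < N) n%:R / 2 ^+ n <= 2 :> R.
Proof.
(* The closed form with its exact remainder makes the bound 2 immediate, and the blocks starting at
   [m] are parts of it. *)
have H k : \sum_(0 <= n < k) n%:R / 2 ^+ n + 2 * k.+1%:R / 2 ^+ k = 2 :> R.
  elim: k => [|k IH]; first by rewrite big_nil add0r expr0 divr1 mulr1.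
  rewrite big_nat_recr//= -[RHS]IH -addrA; congr (_ + _).
  have k0 : 2 ^+ k != 0 :> R by rewrite expf_neq0.
  by rewrite exprS -[k.+2]addn1 -[k.+1]addn1 !natrD; field.
have pos k (n : nat) : 0 <= k%:R / 2 ^+ n :> R by rewrite divr_ge0// exprn_ge0.
have [mN|Nm] := leqP m N; last by rewrite big_geq// ltnW.
rewrite -[leRHS](H N) (big_cat_nat (leq0n m) mN)//=.
have h1 : 0 <= \sum_(0 <= n < m) n%:R / 2 ^+ n :> R by apply: sumr_ge0.
have h2 : 0 <= 2 * N.+1%:R / 2 ^+ N :> R by rewrite -mulrA mulr_ge0.
by lra.
Qed.

Lemma sum_geometric_le (x : R) m N : 0 <= x <= 1/2 ->
  \sum_(m <= n < N) x ^+ n <= 2 * x ^+ m.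
Proof.
move=> /andP[x0 x2].
have [mN|Nm] := leqP m N; last first.
  by rewrite big_geq ?(ltnW Nm)// mulr_ge0// exprn_ge0.
(* The extra term makes induction work: as x <= 1/2, lowering 2 x^N to 2 x^{N+1} pays for the new
   summand x^N. *)
suff : \sum_(m <= n < N) x ^+ n + 2 * x ^+ N <= 2 * x ^+ m.
  by have : 0 <= x ^+ N by [exact: exprn_ge0]; lra.
rewrite -(subnKC mN); elim: (N - m)%N => [|k IH].
  by rewrite addn0 big_geq// add0r.
rewrite addnS big_nat_recr ?leq_addr//=; apply: le_trans IH.
have h : x * x ^+ (m + k) <= 1/2 * x ^+ (m + k) by rewrite ler_wpM2r// exprn_ge0.
by rewrite exprS; lra.
Qed.

(** The mean value inequality for the n-th power on a disc, by induction. For n = 0 the truncated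
    predecessor is harmless because of the factor [n%:R]. *)
Lemma normc_exprB_le (c d : R[i]) (k : R) n : normc c <= k -> normc d <= k ->
  normc (d ^+ n - c ^+ n) <= n%:R * k ^+ n.-1 * normc (d - c).
Proof.
move=> ck dk; have k0 : 0 <= k by exact: le_trans (normc_ge0 c) ck.
case: n => [|n]; first by rewrite !expr0 subrr normc0 mul0r mul0r.
elim: n => [|n IH]; first by rewrite !expr1 expr0 !mul1r.
have -> : d ^+ n.+2 - c ^+ n.+2 = d * (d ^+ n.+1 - c ^+ n.+1) + (d - c) * c ^+ n.+1.
  by rewrite !(exprS _ n.+1); ring.
apply: (le_trans (le_normcD _ _)); rewrite !normcM normcX.
have h1 : normc d * normc (d ^+ n.+1 - c ^+ n.+1) <=
    k * (n.+1%:R * k ^+ n * normc (d - c)).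
  by apply: ler_pM => //; exact: normc_ge0.
have h2 : normc (d - c) * normc c ^+ n.+1 <= normc (d - c) * k ^+ n.+1.
  by rewrite ler_wpM2l ?normc_ge0// lerXn2r ?nnegrE ?normc_ge0.
apply: le_trans (lerD h1 h2) _; rewrite /= -[n.+2]addn1 natrD exprS.
by rewrite le_eqVlt; apply/orP; left; apply/eqP; ring.
Qed.

End SeriesBounds.

(** * Strict differentiability *)

Section StrictDifferential.
Context {R : realType}.
Local Notation C := R[i].

Definition to_complex (z : R * R) : C := z.1 +i* z.2.

Lemma normc_to_complexZ (h : R) (v : R * R) :
  normc (to_complex (h *: v)) = `|h| * normc (to_complex v).
Proof.
rewrite -normc_real -normcM; congr normc.
by apply: complex_ext; rewrite /= /GRing.scale/=; ring.
Qed.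

Lemma normc_le_abs (a b : R) : normc (a +i* b) <= `|a| + `|b|.
Proof.
rewrite -(ler_sqr (x := normc _)) ?nnegrE ?normc_ge0 ?addr_ge0//.
rewrite /= sqr_sqrtr ?addr_ge0 ?sqr_ge0// sqrrD !real_normK ?num_real//.
rewrite addrAC lerDl mulrn_wge0// mulr_ge0//.
Qed.

Lemma near_to_complex (z : R * R) (del : R) : 0 < del ->
  \forall x \near z, normc (to_complex (x - z)) < del.
Proof.
move=> del0; have d2 : 0 < del / 2 by rewrite divr_gt0.
apply: filterS (nbhsx_ballx z _ d2) => x [h1 h2].
apply: le_lt_trans (normc_le_abs _ _) _.
by move: h1 h2; rewrite /ball/= => h1 h2; rewrite distrC (distrC x.2) /=; lra.
Qed.

Lemma near_complexP (z : R * R) (P : set (R * R)) :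
  (\forall x \near z, P x) ->
  exists2 del : R, 0 < del &
    forall x, normc (to_complex (x - z)) < del -> P x.
Proof.
move=> /nbhs_ballP[del /= del0 h]; exists del => // x xz; apply: h.
split; rewrite /ball/= distrC.
  exact: le_lt_trans (normc_Re (to_complex (x - z))) xz.
exact: le_lt_trans (normc_Im (to_complex (x - z))) xz.
Qed.

(** Both endpoints of the increment vary near [z], while the differential stays that at [z]. This
    uniformity yields continuous derivatives. Linearity of [T] is left to the lemmas that use it. *)
Definition strict_diff {V : normedModType R} (F : R * R -> V) (z : R * R)
    (T : R * R -> V) :=
  forall e : R, 0 < e -> exists2 del : R, 0 < del & forall x y : R * R,
    normc (to_complex (x - z)) < del ->
    normc (to_complex (y - z)) < del ->
    `|F y - F x - T (y - x)| <= e * normc (to_complex (y - x)).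

Lemma strict_diff_comp {V W : normedModType R} (L : V -> W) (F : R * R -> V) z T k :
  linear L -> (forall v, `|L v| <= k * `|v|) -> 0 < k ->
  strict_diff F z T -> strict_diff (L \o F) z (L \o T).
Proof.
move=> linL Lk k0 FT e e0; have ek : 0 < e / k by rewrite divr_gt0.
have [del del0 H] := FT _ ek; exists del => // x y xz yz.
have LB u v : L u - L v = L (u - v).
  by have := linL (-1) v u; rewrite !scaleN1r (addrC (- v)) => ->; rewrite addrC.
rewrite /= !LB; apply: le_trans (Lk _) _.
by rewrite mulrC -ler_pdivlMr// mulrAC; exact: H.
Qed.

Lemma strict_diffD {V : normedModType R} (F G : R * R -> V) z S T :
  strict_diff F z S -> strict_diff G z T ->
  strict_diff (fun x => F x + G x) z (fun x => S x + T x).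
Proof.
move=> FS GT e e0; have e2 : 0 < e / 2 by rewrite divr_gt0.
have [d1 d10 H1] := FS _ e2; have [d2 d20 H2] := GT _ e2.
exists (Num.min d1 d2); first by rewrite lt_min d10.
move=> x y; rewrite !lt_min => /andP[x1 x2] /andP[y1 y2].
have -> : F y + G y - (F x + G x) - (S (y - x) + T (y - x)) =
    (F y - F x - S (y - x)) + (G y - G x - T (y - x)).
  by rewrite (opprD (F x)) (addrACA (F y)) (opprD (S _)) [LHS]addrACA.
apply: le_trans (ler_normD _ _) _.
apply: le_trans (lerD (H1 _ _ x1 y1) (H2 _ _ x2 y2)) _.
by rewrite -mulrDl -splitr.
Qed.

Lemma strict_diff_conj {V : normedModType R} (F : R * R -> V) z T :
  strict_diff F (cpx_conj z) T ->
  strict_diff (F \o cpx_conj) z (T \o cpx_conj).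
Proof.
have nJ x : normc (to_complex (cpx_conj x)) = normc (to_complex x).
  by rewrite /= sqrrN.
have cB x y : cpx_conj (x - y) = cpx_conj x - cpx_conj y.
  by apply: injective_projections => //=; rewrite opprD.
move=> FT e /FT[del del0 H]; exists del => // x y xz yz.
by have := H (cpx_conj x) (cpx_conj y); rewrite -!cB !nJ; apply.
Qed.

Lemma strict_diff_derive {V : normedModType R} (F : R * R -> V) z T v :
  (forall (h : R) u, T (h *: u) = h *: T u) ->
  strict_diff F z T -> derivable F z v /\ 'D_v F z = T v.
Proof.
move=> TZ FT.
suff cF : h^-1 *: ((F \o shift z) (h *: v) - F z) @[h --> (0 : R)^'] --> T v.
  by split; [apply/cvg_ex; exists (T v)|exact: cvg_lim cF].
apply/cvgrPdist_le => e e0; set n := normc (to_complex v).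
(* The direction [v] may be 0, so n + 1 takes the place of n in denominators. *)
have n0 : 0 < n + 1 by rewrite ltr_wpDl// normc_ge0.
have en : 0 < e / (n + 1) by rewrite divr_gt0.
have [del del0 H] := FT _ en.
have dn : 0 < del / (n + 1) by rewrite divr_gt0.
near=> h.
have h0 : h != 0 by near: h; exact: nbhs_dnbhs_neq.
have hd : `|h| < del / (n + 1) by near: h; exact: dnbhs0_lt.
have nh : 0 < `|h| by rewrite normr_gt0.
have := H z (h *: v + z).
rewrite subrr normc0 addrK normc_to_complexZ -/n TZ => HH.
have {}HH : `|F (h *: v + z) - F z - h *: T v| <= e / (n + 1) * (`|h| * n).
  apply: HH => //; apply: (@le_lt_trans _ _ (`|h| * (n + 1))).
    by rewrite ler_wpM2l// lerDl.
  by rewrite -ltr_pdivlMr.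
have -> : T v - h^-1 *: ((F \o shift z) (h *: v) - F z) =
    - (h^-1 *: (F (h *: v + z) - F z - h *: T v)).
  by rewrite [in RHS]scalerBr scalerA mulVf// scale1r opprB.
rewrite normrN normrZ normfV mulrC ler_pdivrMr//.
apply: le_trans HH _; have -> : e / (n + 1) * (`|h| * n) = e * `|h| * (n / (n + 1)).
  by field; rewrite gt_eqF.
have q1 : n / (n + 1) <= 1 by rewrite ler_pdivrMr// mul1r lerDl.
by rewrite -[leRHS]mulr1; apply: ler_wpM2l => //; rewrite mulr_ge0// ltW.
Unshelve. all: by end_near. Qed.

(** For w near z, one increment F(w + hv) - F(w) is approximated both by h T_z(v), by strictness at
    z, and by h T_w(v), by differentiability at w. Dividing by h compares the two derivatives. *)
Lemma strict_diff_continuous_derive {V : normedModType R} (F : R * R -> V)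
    (T : R * R -> R * R -> V) (D : set (R * R)) (z v : R * R) :
  (forall w (h : R) u, T w (h *: u) = h *: T w u) ->
  (forall w, D w -> strict_diff F w (T w)) -> open D -> D z ->
  {for z, continuous ('D_v F)}.
Proof.
move=> TZ FT Do Dz; apply/cvgrPdist_le => e e0.
set n := normc (to_complex v).
have n0 : 0 < n + 1 by rewrite ltr_wpDl// normc_ge0.
pose e' := e / (n + 1) / 2.
have e'0 : 0 < e' by rewrite /e' !divr_gt0.
have [del del0 H] := FT z Dz _ e'0.
have DE w : D w -> 'D_v F w = T w v.
  by move=> Dw; have [] := strict_diff_derive F w (T w) v (TZ w) (FT w Dw).
have Dz' : \forall w \near z, D w by apply: open_nbhs_nbhs; split.
apply: filterS2 Dz' (near_to_complex z del del0) => w Dw wz.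
rewrite (DE z Dz) (DE w Dw).
have [del' del'0 H'] := FT w Dw _ e'0.
(* A step shorter than [m] keeps w + hv within [del'] of w and within [del] of z. *)
pose m := Num.min del' (del - normc (to_complex (w - z))).
have m0 : 0 < m by rewrite /m lt_min del'0 subr_gt0.
pose h := m / 2 / (n + 1).
have h0 : 0 < h by rewrite /h !divr_gt0.
have hn : h * n < m.
  have : h * (n + 1) = m / 2 by rewrite /h divfK// gt_eqF.
  by have : h * n <= h * (n + 1) by [rewrite ler_wpM2l ?lerDl// ltW]; lra.
have nw : normc (to_complex (h *: v + w - w)) = h * n.
  by rewrite addrK normc_to_complexZ gtr0_norm.
have y1 : normc (to_complex (h *: v + w - w)) < del'.
  by rewrite nw; apply: lt_le_trans hn _; rewrite ge_min lexx.
have y2 : normc (to_complex (h *: v + w - z)) < del.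
  have -> : h *: v + w - z = (h *: v + w - w) + (w - z) by rewrite addrA subrK.
  apply: le_lt_trans (le_normcD (to_complex (h *: v + w - w)) (to_complex (w - z))) _.
  rewrite nw -ltrBrDr.
  by apply: lt_le_trans hn _; rewrite ge_min lexx orbT.
have w0 : normc (to_complex (w - w)) < del' by rewrite subrr normc0.
have h1 := H _ _ wz y2; have h2 := H' _ _ w0 y1.
have e1 : h *: v + w - w = h *: v by rewrite addrK.
rewrite e1 normc_to_complexZ -/n !TZ (gtr0_norm h0) in h1 h2.
have : `|h *: (T z v - T w v)| <= h * e.
  have -> : h *: (T z v - T w v) = (F (h *: v + w) - F w - h *: T w v) -
      (F (h *: v + w) - F w - h *: T z v).
    by rewrite [RHS]addrC opprB addrA subrK scalerBr.
  apply: le_trans (ler_normB _ _) _; apply: le_trans (lerD h2 h1) _.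
  have -> : e' * (h * n) + e' * (h * n) = (h * e) * (n / (n + 1)).
    by rewrite /e'; field; rewrite gt_eqF.
  have q1 : n / (n + 1) <= 1 by rewrite ler_pdivrMr// mul1r lerDl.
  by rewrite -[leRHS]mulr1; apply: ler_wpM2l => //; rewrite mulr_ge0// ltW.
by rewrite normrZ gtr0_norm// ler_pM2l.
Qed.

End StrictDifferential.

(** * Partial derivatives of real coordinates of vector-valued functions *)

Section PartialDerivatives.
Context {R : realType} {V : normedModType R}.
Variables (m : V -> R) (k : R).
Hypothesis mD : forall x y, m (x + y) = m x + m y.
Hypothesis mZ : forall a x, m (a *: x) = a * m x.
Hypothesis mk : forall x, `|m x| <= k * `|x|.

Let mB x y : m (x - y) = m x - m y.
Proof. by rewrite mD -scaleN1r mZ mulN1r. Qed.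

Lemma bounded_functional_cvg {T : Type} (F : set_system T) {FF : Filter F}
    (f : T -> V) (a : V) : f x @[x --> F] --> a -> m (f x) @[x --> F] --> m a.
Proof.
move=> fa; apply/cvgrPdist_lt => e e0.
have k0 : 0 < `|k| + 1 by rewrite ltr_wpDl.
have ek : 0 < e / (`|k| + 1) by rewrite divr_gt0.
move/cvgrPdist_lt : fa => /(_ _ ek); apply: filterS => x.
rewrite ltr_pdivlMr// -mB mulrC; apply: le_lt_trans.
apply: le_trans (mk _) _; rewrite ler_wpM2r//.
by apply: le_trans (ler_norm k) _; rewrite lerDl.
Qed.

Lemma is_derive_partial1 (F : R * R -> V) (z : R * R) :
  derivable F z (1, 0) ->
  is_derive (z.1 : R) 1 (fun x : R => m (F (x, z.2))) (m ('D_(1, 0) F z)).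
Proof.
move=> dF; suff H : h^-1 *: (m (F (h *: 1 + z.1, z.2)) - m (F z)) @[h --> (0 : R)^']
    --> m ('D_(1, 0) F z).
  have Ez : m (F z) = m (F (z.1, z.2)) by case: (z).
  rewrite Ez in H.
  by apply: DeriveDef; [apply/cvg_ex; exists (m ('D_(1, 0) F z))|exact: cvg_lim H].
have /bounded_functional_cvg := dF.
apply: cvg_trans; apply: near_eq_cvg; near=> h => /=.
rewrite mZ mB; congr (_ * (m (F _) - _)).
by apply: injective_projections => /=; rewrite /GRing.scale/= ?mulr0 ?add0r.
Unshelve. all: by end_near. Qed.

Lemma is_derive_partial2 (F : R * R -> V) (z : R * R) :
  derivable F z (0, 1) ->
  is_derive (z.2 : R) 1 (fun y : R => m (F (z.1, y))) (m ('D_(0, 1) F z)).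
Proof.
move=> dF; suff H : h^-1 *: (m (F (z.1, h *: 1 + z.2)) - m (F z)) @[h --> (0 : R)^']
    --> m ('D_(0, 1) F z).
  have Ez : m (F z) = m (F (z.1, z.2)) by case: (z).
  rewrite Ez in H.
  by apply: DeriveDef; [apply/cvg_ex; exists (m ('D_(0, 1) F z))|exact: cvg_lim H].
have /bounded_functional_cvg := dF.
apply: cvg_trans; apply: near_eq_cvg; near=> h => /=.
rewrite mZ mB; congr (_ * (m (F _) - _)).
by apply: injective_projections => /=; rewrite /GRing.scale/= ?mulr0 ?add0r.
Unshelve. all: by end_near. Qed.

End PartialDerivatives.

(** * Slice functions over an alternative algebra *)

(** Coordinates separate points, so a vector identity can be tested under an arbitrary real linear
    [l]; the tactic [vec] below pushes [l] inward and leaves an identity for [ring] or [field]. *)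
Lemma vec_eq {R : realType} {A : normedModType R} (u v : A) :
  finite_dimensional A ->
  (forall l : A -> R, (forall x y, l (x + y) = l x + l y) ->
    (forall a x, l (a *: x) = a * l x) -> (forall x, l (- x) = - l x) -> l 0 = 0 ->
    l u = l v) -> u = v.
Proof.
move=> /bounded_coordinates[n [e [l [K [llin _ lE]]]]] uv.
rewrite (lE u) (lE v); apply: eq_bigr => i _; congr (_ *: _).
have l0 : l i 0 = 0.
  by have := llin i (-1) 0 0; rewrite scaler0 addr0 mulN1r addNr.
apply: uv => [x y|a x|x|//].
- by have := llin i 1 x y; rewrite scale1r mul1r.
- by have := llin i a x 0; rewrite !addr0 l0 addr0.
- by have := llin i (-1) x 0; rewrite !addr0 l0 addr0 scaleN1r mulN1r.
Qed.

Section SliceAlgebra.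
Context {R : realType} {A : normedModType R} (E : alt_star_alg A).
Local Notation "x ** y" := (amul E x y) (at level 40, left associativity).
Local Notation one := (aone E).
Local Notation C := R[i].
Hypothesis fin_dim : finite_dimensional A.
Hypothesis norm_compat : norm_compatible E.
Implicit Types (x y v : A) (J K : A) (a b p q r : R) (c d z w : C).

Ltac vec :=
  let l := fresh "l" in let lD := fresh "lD" in
  let lZ := fresh "lZ" in let lN := fresh "lN" in let l0 := fresh "l0" in
  apply: (vec_eq _ _ fin_dim); intros l lD lZ lN l0; rewrite !(lD, lZ, lN, l0).

Lemma amulDl x y v : (x + y) ** v = x ** v + y ** v.
Proof. by have := amul_linearl E v 1 x y; rewrite !scale1r. Qed.

Lemma amulDr x y v : v ** (x + y) = v ** x + v ** y.
Proof. by have := amul_linearr E v 1 x y; rewrite !scale1r. Qed.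

Lemma amul0x v : 0 ** v = 0.
Proof.
by have := amulDl 0 0 v; rewrite addr0 -[LHS]addr0 => /addrI <-.
Qed.

Lemma amulx0 v : v ** 0 = 0.
Proof.
by have := amulDr 0 0 v; rewrite addr0 -[LHS]addr0 => /addrI <-.
Qed.

Lemma amulZl a x v : (a *: x) ** v = a *: (x ** v).
Proof. by have := amul_linearl E v a x 0; rewrite amul0x !addr0. Qed.

Lemma amulZr a x v : v ** (a *: x) = a *: (v ** x).
Proof. by have := amul_linearr E v a x 0; rewrite amulx0 !addr0. Qed.

Lemma amulNl x v : (- x) ** v = - (x ** v).
Proof. by rewrite -(scaleN1r x) amulZl scaleN1r. Qed.

Lemma amulNr x v : v ** (- x) = - (v ** x).
Proof. by rewrite -(scaleN1r x) amulZr scaleN1r. Qed.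

Definition amulE := (amulDl, amulDr, amulZl, amulZr, amulNl, amulNr).

Lemma aconjD x y : aconj E (x + y) = aconj E x + aconj E y.
Proof. by have := aconj_linear E 1 x y; rewrite !scale1r. Qed.

Lemma aconjZ a x : aconj E (a *: x) = a *: aconj E x.
Proof.
have a0 : aconj E 0 = 0.
  by have := aconjD 0 0; rewrite addr0 -[LHS]addr0 => /addrI <-.
by have := aconj_linear E a x 0; rewrite !addr0 a0 addr0.
Qed.

Lemma aconjN x : aconj E (- x) = - aconj E x.
Proof. by rewrite -(scaleN1r x) aconjZ scaleN1r. Qed.

Lemma aconj1 : aconj E one = one.
Proof.
have := aconjM E one (aconj E one).
by rewrite aconjK !amul1x aconjK => <-.
Qed.

Lemma scale_one_inj a b : a *: one = b *: one -> a = b.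
Proof.
move=> /eqP; rewrite -subr_eq0 -scalerBl scaler_eq0 (negbTE (aone_neq0 E)).
by rewrite orbF subr_eq0 => /eqP.
Qed.

Lemma im_units_sqr J : im_units E J -> J ** J = - one.
Proof. by case. Qed.

(** J is not real, a real square being non-negative, so J has a real trace t and a real norm n. From
    J(t - J) = n follows tJ = n - 1, and t non-zero would make J real. *)
Lemma im_units_conj J : im_units E J -> aconj E J = - J.
Proof.
move=> [cone JJ].
have nreal r : J <> r *: one.
  move=> Jr; move: JJ; rewrite Jr amulZl amulZr amul1x scalerA -scaleN1r.
  move/scale_one_inj => rr; have := sqr_ge0 r; rewrite expr2 rr; lra.
case: cone => [[r Jr]|[t [n [tr nr _]]]]; first by have := nreal r.
have cJ : aconj E J = t *: one - J by rewrite -tr /atrace addrC addKr.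
move: nr; rewrite /asqnorm cJ amulDr amulNr amulZr amulx1 JJ opprK => tn.
have [t0|t0] := eqVneq t 0; first by rewrite t0 scale0r sub0r.
exfalso; apply: (nreal (t^-1 * (n - 1))).
have -> : J = t^-1 *: (t *: J) by rewrite scalerA mulVf// scale1r.
have -> : t *: J = (n - 1) *: one by rewrite scalerBl -tn scale1r addrK.
by rewrite scalerA.
Qed.

(** Alternativity replaces associativity here: left multiplication by J is a complex structure on
    A. *)
Lemma amul_im_unitK J v : im_units E J -> J ** (J ** v) = - v.
Proof. by move=> /im_units_sqr JJ; rewrite amul_altl JJ amulNl amul1x. Qed.

(** * Points of the slice planes *)

Local Notation sp := (slice_point E).

Lemma slice_pointM J a b p q : im_units E J ->
  sp a b J ** sp p q J = sp (a * p - b * q) (a * q + b * p) J.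
Proof.
move=> /im_units_sqr JJ; rewrite /slice_point !amulE !amul1x amulx1 JJ.
by vec; ring.
Qed.

Lemma slice_pointD J a b p q : sp a b J + sp p q J = sp (a + p) (b + q) J.
Proof. by rewrite /slice_point; vec; ring. Qed.

Lemma slice_pointN J a b : - sp a b J = sp (- a) (- b) J.
Proof. by rewrite /slice_point; vec; ring. Qed.

Lemma slice_point_real J a : sp a 0 J = a *: one.
Proof. by rewrite /slice_point scale0r addr0. Qed.

Lemma slice_point_conj J a b : im_units E J ->
  aconj E (sp a b J) = sp a (- b) J.
Proof.
move=> hJ; rewrite /slice_point aconjD !aconjZ aconj1 im_units_conj//.
by rewrite scalerN scaleNr.
Qed.

Lemma slice_point_cone J a b : im_units E J -> quadratic_cone E (sp a b J).
Proof.
move=> hJ; have [->|b0] := eqVneq b 0.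
  by left; exists a; rewrite slice_point_real.
right; exists (2 * a), (a ^+ 2 + b ^+ 2); split.
- by rewrite /atrace slice_point_conj// slice_pointD subrr slice_point_real mulr2n mulrDl mul1r.
- rewrite /asqnorm slice_point_conj// slice_pointM// -(slice_point_real J).
  by congr (sp _ _ J); ring.
- have : 0 < b ^+ 2 by rewrite exprn_even_gt0.
  by rewrite exprMn; lra.
Qed.

Lemma slice_point_norm J a b : im_units E J ->
  `|sp a b J| = Num.sqrt (a ^+ 2 + b ^+ 2).
Proof.
move=> hJ; apply: norm_compat; first exact: slice_point_cone.
rewrite /asqnorm slice_point_conj// slice_pointM// -(slice_point_real J).
by congr (sp _ _ J); ring.
Qed.

Lemma slice_point_aRe J a b : im_units E J -> aRe E (sp a b J) = a *: one.
Proof.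
move=> hJ; rewrite /aRe slice_point_conj// slice_pointD subrr slice_point_real.
by rewrite scalerA; congr (_ *: _); field.
Qed.

Lemma slice_point_aIm J a b : im_units E J -> aIm E (sp a b J) = b *: J.
Proof.
move=> hJ; rewrite /aIm slice_point_conj// slice_pointN slice_pointD subrr opprK.
by rewrite /slice_point scale0r add0r scalerA; congr (_ *: _); field.
Qed.

Lemma norm_scale_im_unit J b : im_units E J -> `|b *: J| = `|b|.
Proof.
move=> hJ; have := slice_point_norm J 0 b hJ.
by rewrite /slice_point scale0r add0r expr0n add0r sqrtr_sqr.
Qed.

Lemma slice_point_inj J K a b p q : im_units E J -> im_units E K ->
  sp a b J = sp p q K -> a = p /\ b *: J = q *: K.
Proof.
move=> hJ hK e; split.
  by apply: scale_one_inj; rewrite -(slice_point_aRe J a b)// e slice_point_aRe.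
by rewrite -(slice_point_aIm J a b)// e slice_point_aIm.
Qed.

(** Two slice planes meet only in the reals unless J = K or J = -K. Taking norms gives |b| = |q|,
    and a non-zero scalar can be cancelled. *)
Lemma scale_im_unit_eq J K b q : im_units E J -> im_units E K ->
  b *: J = q *: K -> [\/ b = 0 /\ q = 0, b = q /\ J = K | b = - q /\ J = - K].
Proof.
move=> hJ hK e.
have bq : `|b| = `|q| by rewrite -(norm_scale_im_unit J)// e norm_scale_im_unit.
have [b0|b0] := eqVneq b 0.
  by constructor 1; split => //; apply/eqP; rewrite -normr_eq0 -bq b0 normr0.
have /orP[/eqP eb|/eqP eb] : (b == q) || (b == - q) by rewrite -eqr_norm2 bq eqxx.
- constructor 2; split=> //; apply: (scalerI b0); by rewrite e eb.
- constructor 3; split=> //; apply: (scalerI b0); by rewrite e eb scalerN scaleNr opprK.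
Qed.

(** The value chosen by [xget] may come from another representation of the point: a real one, or one
    with b and J both negated. The parity of F at this one pair makes all of them agree. *)
Lemma slice_extE (F : R * R -> A * A) J a b : im_units E J ->
  (F (a, - b)).1 = (F (a, b)).1 -> (F (a, - b)).2 = - (F (a, b)).2 ->
  slice_ext E F (sp a b J) = (F (a, b)).1 + J ** (F (a, b)).2.
Proof.
move=> hJ F1 F2; rewrite /slice_ext.
set S := [set w | _].
have Sw : S ((F (a, b)).1 + J ** (F (a, b)).2) by exists a, b, J.
have [p [q [K [hK e ->]]]] : S (xget 0 S) by exact: xgetI Sw.
have [<- bq] := slice_point_inj _ _ _ _ _ _ hJ hK e.
have [[b0 q0]|[<- <-]|[b0 JK]] := scale_im_unit_eq _ _ _ _ hJ hK bq.
- rewrite b0 q0 oppr0 in F2 *.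
  (* An odd component vanishes on the real axis, so the choice of unit is irrelevant there. *)
  have F20 : (F (a, 0)).2 = 0.
    have : 2 *: (F (a, 0)).2 = 0 by rewrite scaler_nat mulr2n {1}F2 addNr.
    by move/eqP; rewrite scaler_eq0 pnatr_eq0/= => /eqP.
  by rewrite F20 !amulx0.
- by [].
- have -> : q = - b by rewrite b0 opprK.
  by rewrite F1 F2 JK amulNl amulNr.
Qed.

(** Completing the square in x^2 = tx - n: the element x - t/2, divided by the square root of n -
    t^2/4, squares to -1. A real x borrows the given unit. *)
Lemma cone_slice_point x : im_units E !=set0 -> quadratic_cone E x ->
  exists a b J, im_units E J /\ x = sp a b J.
Proof.
move=> [J0 hJ0] [[r ->]|[t [n [tr nr tn]]]].
  by exists r, 0, J0; rewrite slice_point_real.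
pose m := n - t ^+ 2 / 4; pose s := Num.sqrt m.
have m0 : 0 < m by rewrite /m; lra.
have s0 : 0 < s by rewrite sqrtr_gt0.
have ss : s ^+ 2 = m by rewrite sqr_sqrtr// ltW.
have cx : aconj E x = t *: one - x by rewrite -tr /atrace addrC addKr.
have xx : x ** x = t *: x - n *: one.
  by rewrite -nr /asqnorm cx amulDr amulNr amulZr amulx1 opprB addrC subrK.
pose J := s^-1 *: (x - (t / 2) *: one).
have JJ : J ** J = - one.
  rewrite /J !amulE !amul1x !amulx1 xx; vec.
  have -> : n = s ^+ 2 + t ^+ 2 / 4 by rewrite ss /m; ring.
  by field; rewrite gt_eqF.
have cJ : aconj E J = - J.
  rewrite /J aconjZ aconjD aconjN aconjZ aconj1 cx; vec; by field; rewrite gt_eqF.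
exists (t / 2), s, J; split; last first.
  by rewrite /slice_point /J scalerA divff ?gt_eqF// scale1r addrC subrK.
split => //; right; exists 0, 1; split.
- by rewrite /atrace cJ subrr scale0r.
- by rewrite /asqnorm cJ amulNr JJ opprK scale1r.
- by lra.
Qed.

(** * The complex structure of a unit and the change of unit *)

Definition act J c v : A := Re c *: v + Im c *: (J ** v).

Lemma act_linear J c : linear (act J c).
Proof. by move=> a x y; rewrite /act !amulE; vec; ring. Qed.

Lemma actM J c d v : im_units E J -> act J (c * d) v = act J c (act J d v).
Proof.
move=> hJ; rewrite /act ReM ImM !amulE amul_im_unitK//; vec; ring.
Qed.

Lemma act1 J v : act J 1 v = v.
Proof. by rewrite /act /= scale1r scale0r addr0. Qed.

Lemma amul_slice_point J a b v : sp a b J ** v = act J (a +i* b) v.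
Proof. by rewrite /slice_point !amulE amul1x. Qed.

(* The two halves of the representation formula; [to_unit J K] carries the complex
   structure J to K, and [to_unitc J K] carries it to - K. *)
Definition to_unit J K v : A := 2^-1 *: (v - K ** (J ** v)).
Definition to_unitc J K v : A := 2^-1 *: (v + K ** (J ** v)).

Lemma to_unit_linear J K : linear (to_unit J K).
Proof. by move=> a x y; rewrite /to_unit !amulE; vec; ring. Qed.

Lemma to_unitc_linear J K : linear (to_unitc J K).
Proof. by move=> a x y; rewrite /to_unitc !amulE; vec; ring. Qed.

Lemma to_unitD J K v : to_unit J K v + to_unitc J K v = v.
Proof. by rewrite /to_unit /to_unitc; vec; field. Qed.

Lemma to_unit_id J v : im_units E J -> to_unit J J v = v.
Proof. by move=> hJ; rewrite /to_unit amul_im_unitK//; vec; field. Qed.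

Lemma to_unitc_id J v : im_units E J -> to_unitc J J v = 0.
Proof. by move=> hJ; rewrite /to_unitc amul_im_unitK// subrr scaler0. Qed.

Lemma to_unit_act J K c v : im_units E J -> im_units E K ->
  to_unit J K (act J c v) = act K c (to_unit J K v).
Proof.
move=> hJ hK; rewrite /to_unit /act !amulE !amul_im_unitK// !amulE.
by vec; ring.
Qed.

Lemma to_unitc_act J K c v : im_units E J -> im_units E K ->
  to_unitc J K (act J c v) = act K c^*%C (to_unitc J K v).
Proof.
move=> hJ hK; rewrite /to_unitc /act !amulE !amul_im_unitK// !amulE.
by case: c => c1 c2 /=; vec; ring.
Qed.

(** The complexification of the plane of J splits as C x C through the idempotents (1 - iJ)/2 and (1
    + iJ)/2. There z - y becomes the pair (z - w, z - conj w), powers are taken factorwise, and the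
    formula reads the result back in A x A. *)
Lemma cexp_slice_point J a b p q n : im_units E J ->
  let z := a +i* b in let w := p +i* q in
  cexp E (cpx_embed E (a, b) - alg_embed (sp p q J)) n =
  (sp ((Re ((z - w) ^+ n) + Re ((z - w^*%C) ^+ n)) / 2)
      ((Im ((z - w) ^+ n) - Im ((z - w^*%C) ^+ n)) / 2) J,
   sp ((Im ((z - w) ^+ n) + Im ((z - w^*%C) ^+ n)) / 2)
      ((Re ((z - w^*%C) ^+ n) - Re ((z - w) ^+ n)) / 2) J).
Proof.
move=> hJ z w; elim: n => [|n IH].
  rewrite /cexp/= /slice_point; congr (_, _).
    by vec; field.
  by vec; field.
rewrite /cexp iterS -/(cexp _ _ _) IH /cmul /cpx_embed /alg_embed /= subr0.
rewrite -!(slice_point_real J) slice_pointN slice_pointD !slice_pointM//.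
rewrite slice_pointN !slice_pointD !exprS !ReM !ImM.
move: ((z - w) ^+ n) ((z - w^*%C) ^+ n) => [c1 c2] [d1 d2].
rewrite /z /w /=.
by congr (sp _ _ J, sp _ _ J); field.
Qed.

Lemma cmul_conj (u v : A * A) :
  cmul E (u.1, - u.2) (v.1, - v.2) = ((cmul E u v).1, - (cmul E u v).2).
Proof. by rewrite /cmul /= !amulE opprK opprD. Qed.

Lemma cexp_conj (u : A * A) n :
  cexp E (u.1, - u.2) n = ((cexp E u n).1, - (cexp E u n).2).
Proof.
elim: n => [|n IH]; first by rewrite /cexp/= oppr0.
by rewrite /cexp !iterS -!/(cexp _ _ _) IH cmul_conj.
Qed.

(** The monomial is induced by a stem function, so its value on the plane of K is determined by
    those at z and conj z on the plane of J, where it is an ordinary power. *)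
Lemma slice_monomialE J K a b p q n v : im_units E J -> im_units E K ->
  let z := a +i* b in let w := p +i* q in
  slice_monomial E (sp p q J) n v (sp a b K) =
  to_unit J K (act J ((z - w) ^+ n) v) + to_unitc J K (act J ((z^*%C - w) ^+ n) v).
Proof.
move=> hJ hK z w; rewrite /slice_monomial.
set F := (F in slice_ext _ F).
have Fconj : F (a, - b) = ((F (a, b)).1, - (F (a, b)).2).
  rewrite /F; set u := cpx_embed E (a, b) - _.
  have -> : cpx_embed E (a, - b) - alg_embed (sp p q J) = (u.1, - u.2).
    by apply: injective_projections; rewrite /u /cpx_embed /alg_embed //= !subr0 scaleNr.
  rewrite cexp_conj -cmul_conj; congr cmul; rewrite /alg_embed /=.
  by rewrite oppr0.
rewrite slice_extE// ?Fconj// /F cexp_slice_point// -/z -/w /cmul /alg_embed /=.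
rewrite !amulx0 subr0 add0r !amul_slice_point.
have -> : (z^*%C - w) ^+ n = ((z - w^*%C) ^+ n)^*%C.
  by rewrite rmorphXn; congr (_ ^+ n); apply: complex_ext => /=; ring.
move: ((z - w) ^+ n) ((z - w^*%C) ^+ n) => [c1 c2] [d1 d2].
rewrite /to_unit /to_unitc /act /= !amulE !amul_im_unitK// !amulE.
by vec; field.
Qed.

(** * Balls of the sigma-distance *)

Lemma sigma_dist_ge0 x y : 0 <= sigma_dist E x y.
Proof. by rewrite /sigma_dist; case: asboolP => _; [|exact: sqrtr_ge0]. Qed.

Lemma sigma_dist_slice J a b p q : im_units E J ->
  sigma_dist E (sp a b J) (sp p q J) = normc ((a +i* b) - (p +i* q)).
Proof.
move=> hJ; rewrite /sigma_dist; case: asboolP => [_|[]]; last first.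
  by exists J => //; split; [exists p, q|exists a, b].
by rewrite slice_pointN slice_pointD slice_point_norm.
Qed.

Lemma sigma_ball_slice J a b p q r : im_units E J ->
  normc ((a +i* b) - (p +i* q)) < r -> sigma_ball E (sp p q J) r (sp a b J).
Proof.
by move=> hJ h; split; [exact: slice_point_cone|rewrite sigma_dist_slice].
Qed.

Lemma sigma_ball_radius y r : sigma_ball E y r !=set0 -> 0 < r.
Proof. by move=> [x [_]]; apply: le_lt_trans; exact: sigma_dist_ge0. Qed.

(** A point off the plane of J lies in the ball only if both z and conj z are within r of w, which
    is what convergence of the transported series requires there. In the plane of J itself, z alone
    has to be close. *)
Lemma sigma_ballP x J p q r : im_units E J -> sigma_ball E (sp p q J) r x ->
  exists a b K, [/\ im_units E K, x = sp a b K &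
    (K = J /\ normc ((a +i* b) - (p +i* q)) < r) \/
    (normc ((a +i* b) - (p +i* q)) < r /\
     normc ((a +i* b)^*%C - (p +i* q)) < r)].
Proof.
move=> hJ [xQ]; rewrite /sigma_dist; case: asboolP => [[K hK [[p' [q' yE]] [a [b ->]]]]|_].
  rewrite yE slice_pointN slice_pointD slice_point_norm// => lt_r.
  have [pp qq] := slice_point_inj _ _ _ _ _ _ hJ hK yE; subst p'.
  have [[q0 q'0]|[qE JK]|[qE JK]] := scale_im_unit_eq _ _ _ _ hJ hK qq.
  (* A real centre lies in every plane, and z and conj z are equally far from it. *)
  - exists a, b, K; split=> //; right; subst q q'.
    by rewrite /= !subr0 sqrrN in lt_r *.
  - by subst q' K; exists a, b, J; split => //; left.
  - exists a, (- b), J; split => //.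
      by rewrite /slice_point JK scalerN scaleNr opprK.
    left; split => //=; subst q; move: lt_r.
    by rewrite opprK -(sqrrN (b - q')) opprB [- b + _]addrC.
have [a [b [K [hK xE]]]] := cone_slice_point x (ex_intro _ J hJ) xQ.
rewrite xE !slice_point_aRe// !slice_point_aIm// !norm_scale_im_unit//.
have -> : a *: one - p *: one = sp (a - p) 0 K.
  by rewrite slice_point_real scalerBl.
rewrite slice_point_norm// expr0n addr0 sqrtr_sqr real_normK ?num_real//.
have hb : `|b| ^+ 2 = b ^+ 2 by rewrite real_normK ?num_real.
have hq : `|q| ^+ 2 = q ^+ 2 by rewrite real_normK ?num_real.
have hbq : `|b * q| <= `|b| * `|q| by rewrite normrM.
have hbq1 := ler_norm (b * q); have hbq2 := ler_norm (- (b * q)).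
rewrite normrN in hbq2.
move=> lt_r; exists a, b, K; split => //; right.
(* The sum |b| + |q| of the sigma-distance dominates both |b - q| and |b + q|. *)
have hs : (`|b| + `|q|) ^+ 2 = b ^+ 2 + 2 * (`|b| * `|q|) + q ^+ 2.
  by rewrite -hb -hq; ring.
have e1 : (b - q) ^+ 2 <= (`|b| + `|q|) ^+ 2 by rewrite hs; lra.
have e2 : (- b - q) ^+ 2 <= (`|b| + `|q|) ^+ 2 by rewrite hs; lra.
by split; apply: le_lt_trans lt_r => /=; apply: ler_wsqrtr; rewrite lerD2l.
Qed.

(** * Power series with respect to the complex structure of a unit *)

Definition has_pseries J (g : C -> A) (w : C) :=
  exists2 r : R, 0 < r & exists s : nat -> A, forall z, normc (z - w) < r ->
    series (fun n => act J ((z - w) ^+ n) (s n)) @ \oo --> g z.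

Lemma act_bounded J : exists2 k : R, 0 < k &
  forall c v, `|act J c v| <= k * normc c * `|v|.
Proof.
have linJ : linear (amul E J) := amul_linearr E J.
have [k k0 kJ] := linear_bounded _ _ fin_dim linJ.
exists (1 + k); first by rewrite addr_gt0.
move=> c v; apply: (le_trans (ler_normD _ _)); rewrite !normrZ.
have h1 : `|Re c| * `|v| <= normc c * `|v|.
  by rewrite ler_wpM2r// normc_Re.
have h2 : `|Im c| * `|J ** v| <= normc c * (k * `|v|).
  by apply: ler_pM => //; exact: normc_Im.
by apply: le_trans (lerD h1 h2) _; rewrite le_eqVlt; apply/orP; left; apply/eqP; ring.
Qed.

Lemma act_real J r v : act J r%:C v = r *: v.
Proof. by rewrite /act /= scale0r addr0. Qed.

(** Convergence at a single point suffices: the terms tend to 0, hence are bounded, and at a real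
    argument the action is plain scaling. *)
Lemma cauchy_estimate J (s : nat -> A) (r : R) (l : A) : 0 < r ->
  series (fun n => act J (r%:C ^+ n) (s n)) @ \oo --> l ->
  exists2 M : R, 0 < M & forall n, `|s n| <= M / r ^+ n.
Proof.
move=> r0 sl.
have t0 : (fun n => act J (r%:C ^+ n) (s n)) @ \oo --> (0 : A).
  by apply: cvg_series_cvg_0; apply/cvg_ex; exists l.
have : bounded_fun (fun n => act J (r%:C ^+ n) (s n)).
  by apply: cvg_seq_bounded; apply/cvg_ex; exists 0.
move=> /pinfty_ex_gt0[M M0 /= MP]; exists M => //.
move=> n; have rn : 0 < r ^+ n by rewrite exprn_gt0.
rewrite ler_pdivlMr//.
by have := MP n I; rewrite -rmorphXn act_real normrZ gtr0_norm// mulrC.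
Qed.

Lemma has_pseries_estimate J g w : has_pseries J g w ->
  exists (r M : R) (s : nat -> A), [/\ 0 < r, 0 < M,
    forall n, `|s n| <= M / r ^+ n &
    forall z, normc (z - w) <= r ->
      series (fun n => act J ((z - w) ^+ n) (s n)) @ \oo --> g z].
Proof.
move=> [r r0 [s sg]].
have r20 : 0 < r / 2 by rewrite divr_gt0.
have lt2 : r / 2 < r by rewrite ltr_pdivrMr// mulr_natr mulr2n ltrDl.
have := sg (w + (r / 2)%:C); rewrite addrC addKr.
rewrite normc_real gtr0_norm// => /(_ lt2) /(cauchy_estimate J s _ _ r20)[M M0 sM].
exists (r / 2), M, s; split => // z zw; apply: sg; exact: le_lt_trans zw lt2.
Qed.

Lemma seriesB (V : normedModType R) (f g : nat -> V) (l m : V) :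
  series f @ \oo --> l -> series g @ \oo --> m ->
  series (fun n => f n - g n) @ \oo --> l - m.
Proof.
move=> fl gm; have -> : series (fun n => f n - g n) = series f - series g.
  by apply/funext => n; rewrite /series/= sumrB.
exact: cvgB.
Qed.

(** The differential is given by the coefficient of degree 1; the terms of degree at least 2
    contribute an increment that is small relative to z' - z. *)
Lemma has_pseries_strict J g w : im_units E J -> has_pseries J g w ->
  exists d : A, forall e : R, 0 < e -> exists2 del : R, 0 < del &
    forall z z', normc (z - w) < del -> normc (z' - w) < del ->
      `|g z' - g z - act J (z' - z) d| <= e * normc (z' - z).
Proof.
move=> hJ /has_pseries_estimate[r [M [s [r0 M0 sM sg]]]].
have [k k0 kJ] := act_bounded J.
exists (s 1) => e e0.
(* In the term of degree n, one factor [del] is kept and the other n - 2 are bounded by r/2, leaving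
   4kM del/r^2 times n/2^n; summing n/2^n gives the further factor 2. *)
pose B := 8 * k * M / r ^+ 2.
have B0 : 0 < B by rewrite /B !mulr_gt0 ?invr_gt0 ?exprn_gt0.
pose del := Num.min (r / 2) (e / B).
have del0 : 0 < del by rewrite lt_min; apply/andP; split; apply: divr_gt0.
exists del => // z z' zw z'w.
have delr : del <= r / 2 by rewrite ge_min lexx.
have dele : del <= e / B by rewrite ge_min lexx orbT.
have ler2 : r / 2 <= r by rewrite ler_pdivrMr// mulr_natr mulr2n lerDl ltW.
have zr : normc (z - w) <= r by lra.
have z'r : normc (z' - w) <= r by lra.
set N := normc (z' - z).
have N0 : 0 <= N by exact: normc_ge0.
pose u n := act J ((z' - w) ^+ n - (z - w) ^+ n) (s n).
have ul : series u @ \oo --> g z' - g z.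
  have -> : u = fun n => act J ((z' - w) ^+ n) (s n) - act J ((z - w) ^+ n) (s n).
    apply/funext => n; rewrite /u /act.
    by move: ((z' - w) ^+ n) ((z - w) ^+ n) => [? ?] [? ?] /=; vec; ring.
  exact: seriesB (sg z' z'r) (sg z zr).
have u01 : \sum_(0 <= n < 2) u n = act J (z' - z) (s 1).
  rewrite big_nat_recr//= big_nat1 /u !expr0 subrr !expr1.
  rewrite {1}/act /= !scale0r addr0 add0r; congr (act J _ _).
  by rewrite opprB addrA subrK.
rewrite -u01; apply: series_tail_le ul _ => m.
have uB n : `|u n| <= (4 * k * M * del / r ^+ 2 * N) * (n%:R / 2 ^+ n) \/ (n < 2)%N.
  have [n2|n2] := ltnP n 2; [by right|left].
  have h1 := normc_exprB_le _ _ _ n (ltW zw) (ltW z'w).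
  have e1 : z' - w - (z - w) = z' - z by rewrite opprB addrA subrK.
  rewrite e1 -/N in h1.
  apply: (le_trans (kJ _ _)).
  have h2 : k * normc ((z' - w) ^+ n - (z - w) ^+ n) * `|s n| <=
     k * (n%:R * del ^+ n.-1 * N) * (M / r ^+ n).
    by apply: ler_pM => //; [rewrite mulr_ge0 ?normc_ge0// ltW|rewrite ler_pM2l].
  apply: le_trans h2 _.
  have rn : 0 < r ^+ n by rewrite exprn_gt0.
  have h3 : del ^+ n.-1 <= del * (r / 2) ^+ n.-2.
    case: n n2 {h1 rn} => [|[|n]] // _; rewrite exprS ler_pM2l//=.
    by apply: lerXn2r => //; rewrite nnegrE ltW ?divr_gt0.
  have h4 : r ^+ n = r ^+ 2 * r ^+ n.-2 by rewrite -exprD; case: n n2 {h1 rn h3} => [|[|]].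
  have h5 : 2 ^+ n = 4 * 2 ^+ n.-2 :> R.
    have -> : 4 = 2 ^+ 2 :> R by rewrite expr2; ring.
    by rewrite -exprD; case: n n2 {h1 rn h3 h4} => [|[|]].
  have r2 : 0 < r ^+ n.-2 by rewrite exprn_gt0.
  have t2 : 0 < 2 ^+ n.-2 :> R by rewrite exprn_gt0.
  have -> : 4 * k * M * del / r ^+ 2 * N * (n%:R / 2 ^+ n) =
      k * (n%:R * (del * (r / 2) ^+ n.-2) * N) * (M / r ^+ n).
    rewrite h4 h5 expr_div_n; field.
    by rewrite !gt_eqF.
  apply: ler_pM => //.
  - by rewrite !mulr_ge0// ?exprn_ge0// ltW.
  - by rewrite divr_ge0// ltW.
  - rewrite ler_pM2l// ler_wpM2r// ler_wpM2l//.
have : \sum_(2 <= n < m) `|u n| <=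
    \sum_(2 <= n < m) (4 * k * M * del / r ^+ 2 * N) * (n%:R / 2 ^+ n).
  by apply: ler_sum_nat => n /andP[n2 _]; have [//|] := uB n; rewrite ltnNge n2.
move/le_trans; apply; rewrite -mulr_sumr.
have P0 : 0 <= 4 * k * M * del / r ^+ 2 * N.
  by rewrite !mulr_ge0// ?invr_ge0 ?exprn_ge0// ltW.
apply: (@le_trans _ _ (4 * k * M * del / r ^+ 2 * N * 2)).
  by rewrite ler_wpM2l// sum_nat_half_le.
have -> : 4 * k * M * del / r ^+ 2 * N * 2 = (del * B) * N by rewrite /B; ring.
by rewrite ler_wpM2r// -ler_pdivlMr.
Qed.

(** If the coefficients below m vanish, then at a zero close to w the term of degree m is cancelled
    by the tail, so the norm of s_m is at most a constant times the distance to w. That distance is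
    arbitrarily small. *)
Lemma pseries_identity J g w : im_units E J -> has_pseries J g w ->
  (forall del : R, 0 < del -> exists z, [/\ z != w, normc (z - w) < del & g z = 0]) ->
  exists2 r : R, 0 < r & forall z, normc (z - w) <= r -> g z = 0.
Proof.
move=> hJ /has_pseries_estimate[r [M [s [r0 M0 sM sg]]]] gw.
have [k k0 kJ] := act_bounded J.
suff s0 n : s n = 0.
  exists r => // z zr.
  have := sg z zr; have -> : series (fun n => act J ((z - w) ^+ n) (s n)) = fun=> 0.
    apply/funext => n; rewrite /series/= big1// => i _.
    by rewrite s0 /act amulx0 !scaler0 addr0.
  move=> h; have h0 : (fun=> 0 : A) @ \oo --> (0 : A) by exact: cvg_cst.
  exact: (cvg_unique _ h h0).
elim/ltn_ind: n => m IH.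
(* The inner constant bounds the geometric tail; the outer [k] is the cost of undoing the action of
   x^m, the norm of A not being assumed multiplicative. *)
pose B := k * (2 * k * M / r ^+ m.+1).
have B0 : 0 < B by rewrite /B !mulr_gt0 ?invr_gt0 ?exprn_gt0.
apply/eqP; rewrite -normr_le0; apply/ler_addgt0Pr => e e0; rewrite add0r.
have del0 : 0 < Num.min (r / 2) (e / B) by rewrite lt_min; apply/andP; split; apply: divr_gt0.
have [z [zw zdel gz]] := gw _ del0.
set x := z - w in zdel *.
have x0 : x != 0 by rewrite subr_eq0.
have nx0 : 0 < normc x.
  rewrite lt_def normc_ge0 andbT; apply: contraNN x0 => /eqP /eq0_normc ->.
  by rewrite eqxx.
have xr2 : normc x <= r / 2 by move: zdel; rewrite lt_min => /andP[/ltW].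
have xe : normc x <= e / B by move: zdel; rewrite lt_min => /andP[_ /ltW].
have ler2 : r / 2 <= r by rewrite ler_pdivrMr// mulr_natr mulr2n lerDl ltW.
pose u n := act J (x ^+ n) (s n).
have ul : series u @ \oo --> (0 : A) by rewrite -gz; apply: sg; exact: le_trans xr2 ler2.
have um : \sum_(0 <= n < m.+1) u n = u m.
  rewrite big_nat_recr//= big_nat big1 ?add0r// => i /andP[_ im].
  by rewrite /u IH// /act amulx0 !scaler0 addr0.
pose q := normc x / r.
have q01 : 0 <= q <= 1/2.
  apply/andP; split; first by apply: divr_ge0; [exact: normc_ge0|exact: ltW].
  by rewrite /q ler_pdivrMr//; lra.
have uB n : `|u n| <= k * M * q ^+ n.
  apply: (le_trans (kJ _ _)); rewrite normcX.
  have -> : k * M * q ^+ n = k * normc x ^+ n * (M / r ^+ n).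
    by rewrite /q expr_div_n; ring.
  by rewrite ler_wpM2l// mulr_ge0 ?exprn_ge0 ?normc_ge0// ltW.
have umB : `|u m| <= 2 * k * M * q ^+ m.+1.
  have := series_tail_le u 0 m.+1 (2 * k * M * q ^+ m.+1) ul.
  rewrite um sub0r normrN; apply => N.
  apply: (@le_trans _ _ (\sum_(m.+1 <= n < N) k * M * q ^+ n)).
    by apply: ler_sum.
  rewrite -mulr_sumr.
  have := sum_geometric_le q m.+1 N q01.
  have kM : 0 <= k * M by rewrite mulr_ge0// ltW.
  move/(ler_wpM2l kM)/le_trans; apply.
  by rewrite le_eqVlt; apply/orP; left; apply/eqP; ring.
have -> : s m = act J (x ^- m) (u m).
  by rewrite /u -actM// mulVf ?expf_neq0// act1.
apply: le_trans (kJ _ _) _.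
rewrite normcV normcX.
have xm : 0 < normc x ^+ m by rewrite exprn_gt0.
have h : k * (normc x ^+ m)^-1 * `|u m| <= k * (normc x ^+ m)^-1 * (2 * k * M * q ^+ m.+1).
  by rewrite ler_wpM2l// mulr_ge0 ?invr_ge0 ?ltW.
apply: le_trans h _.
have -> : k * (normc x ^+ m)^-1 * (2 * k * M * q ^+ m.+1) = normc x * B.
  rewrite /q /B expr_div_n [normc x ^+ m.+1]exprS; field.
  by rewrite !gt_eqF ?exprn_gt0.
by rewrite -ler_pdivlMr.
Qed.

(** The stem function is half of g(z) + g(conj z) and -J/2 times g(z) - g(conj z), where g is the
    restriction of f to the plane of J. *)
Lemma slice_regular_of_pseries (D : set (R * R)) (f : A -> A) J :
  im_units E J -> open D -> (forall z : R * R, D z -> D (cpx_conj z)) ->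
  (forall w : R * R, D w -> has_pseries J (fun z => f (sp (Re z) (Im z) J)) (to_complex w)) ->
  (forall K (z : R * R), im_units E K -> D z ->
    f (sp z.1 z.2 K) = to_unit J K (f (sp z.1 z.2 J)) +
                       to_unitc J K (f (sp z.1 (- z.2) J))) ->
  slice_regular E D f.
Proof.
move=> hJ Do Dc fps frep.
pose g (z : R * R) := f (sp z.1 z.2 J).
(* [L1] turns multiplication by J into multiplication by i, and [L2] into multiplication by -i; the
   conjugation put before [L2] in F compensates, so both summands are holomorphic. *)
pose L1 (v : A) : (A * A)%type := (2^-1 *: v, - (2^-1 *: (J ** v))).
pose L2 (v : A) : (A * A)%type := (2^-1 *: v, 2^-1 *: (J ** v)).
have linL1 : linear L1.
  move=> a x y; apply: injective_projections; rewrite /L1 /= ?amulE; vec; ring.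
have linL2 : linear L2.
  move=> a x y; apply: injective_projections; rewrite /L2 /= ?amulE; vec; ring.
pose F (z : R * R) := L1 (g z) + L2 (g (cpx_conj z)).
have F1 (z : R * R) : (F z).1 = 2^-1 *: (g z + g (cpx_conj z)) by rewrite /= scalerDr.
have F2 (z : R * R) : (F z).2 = 2^-1 *: (J ** (g (cpx_conj z) - g z)).
  by rewrite /= !amulE scalerDr scalerN addrC.
have conjK (z : R * R) : cpx_conj (cpx_conj z) = z.
  by apply: injective_projections => //=; rewrite opprK.
have /choice[d dP] : forall w : R * R, exists d : A, D w ->
    strict_diff g w (fun v : R * R => act J (to_complex v) d).
  move=> w; have [Dw|nDw] := pselect (D w); last by exists 0.
  have [d H] := has_pseries_strict J _ _ hJ (fps w Dw).
  exists d => _ e /H[del del0 {}H]; exists del => // x y xw yw.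
  exact: (H (to_complex x) (to_complex y) xw yw).
pose T (w v : R * R) := L1 (act J (to_complex v) (d w)) +
              L2 (act J (to_complex (cpx_conj v)) (d (cpx_conj w))).
have FT (w : R * R) : D w -> strict_diff F w (T w).
  move=> Dw; have [k1 k10 B1] := linear_bounded _ _ fin_dim linL1.
  have [k2 k20 B2] := linear_bounded _ _ fin_dim linL2.
  apply: strict_diffD; first exact: strict_diff_comp linL1 B1 k10 (dP w Dw).
  have := strict_diff_conj g w _ (dP _ (Dc w Dw)).
  exact: (strict_diff_comp L2 (g \o cpx_conj) w _ k2 linL2 B2 k20).
have TZ (w : R * R) (h : R) (u : R * R) : T w (h *: u) = h *: T w u.
  apply: injective_projections; rewrite /T /L1 /L2 /act /= ?amulE /GRing.scale/=;
  by vec; ring.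
have DF (z v : R * R) : D z -> derivable F z v /\ 'D_v F z = T z v.
  by move=> Dz; apply: strict_diff_derive (TZ z) (FT z Dz).
exists F; split.
- split.
    by move=> z Dz; rewrite !F1 !F2 conjK (addrC (g _)) -scalerN -amulNr opprB.
  move=> x [a [b [K [Dab hK ->]]]]; rewrite (slice_extE F)//; last 2 first.
    by rewrite !F1 -[(a, - b)]/(cpx_conj (a, b)) conjK addrC.
    by rewrite !F2 -[(a, - b)]/(cpx_conj (a, b)) conjK -scalerN -amulNr opprB.
  rewrite (frep K (a, b) hK Dab) F1 F2 /to_unit /to_unitc /g /= !amulE.
  by vec; ring.
- move=> z Dz; split.
  + by have [] := DF z (1, 0) Dz.
  + by have [] := DF z (0, 1) Dz.
  + exact: strict_diff_continuous_derive TZ FT Do Dz.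
  + exact: strict_diff_continuous_derive TZ FT Do Dz.
(* In direction (0, 1) the differential acts by i, that is by J, and J(Jv) = -v cancels the two
   partial derivatives. *)
- move=> z Dz; rewrite /dbar; have [_ ->] := DF z (1, 0) Dz.
  have [_ ->] := DF z (0, 1) Dz.
  rewrite /T /L1 /L2 /cimul /act.
  apply: injective_projections => /=; rewrite ?amulE ?amul_im_unitK//.
    by vec; field.
  by vec; field.
Qed.

(** For each coordinate l, the functional l(v) - i l(Jv) is complex linear for the structure of J,
    so its composite with F_1 + J F_2 is an ordinary holomorphic function, to which
    [holomorphic_series] applies. *)
Lemma holomorphic_has_pseries (D : set (R * R)) (F : R * R -> A * A) J
    (w : R * R) :
  im_units E J -> open D -> class_C1 D F -> (forall z : R * R, D z -> dbar F z = 0) ->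
  D w ->
  has_pseries J (fun z => (F (Re z, Im z)).1 + J ** (F (Re z, Im z)).2)
    (to_complex w).
Proof.
move=> hJ Do C1 F0 Dw.
have [n [e [l [K [llin lK lE]]]]] := bounded_coordinates fin_dim.
have linJ : linear (amul E J) := amul_linearr E J.
have [k k0 kJ] := linear_bounded _ _ fin_dim linJ.
have l0 i : l i 0 = 0.
  by have := llin i (-1) 0 0; rewrite scaler0 addr0 mulN1r addNr.
have lD i x y : l i (x + y) = l i x + l i y.
  by have := llin i 1 x y; rewrite scale1r mul1r.
have lZ i (a : R) x : l i (a *: x) = a * l i x.
  by have := llin i a x 0; rewrite !addr0 l0 addr0.
have lN i x : l i (- x) = - l i x by rewrite -scaleN1r lZ mulN1r.
pose Q (u : A * A) : A := u.1 + J ** u.2.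
have QD (x y : A * A) : Q (x + y) = Q x + Q y by rewrite /Q /= amulDr addrACA.
have QZ (a : R) (x : A * A) : Q (a *: x) = a *: Q x by rewrite /Q /= amulZr scalerDr.
have Qk (x : A * A) : `|Q x| <= (1 + k) * `|x|.
  have h1 : `|x.1| <= `|x| by rewrite prod_normE le_max lexx.
  have h2 : `|x.2| <= `|x| by rewrite prod_normE le_max lexx orbT.
  apply: le_trans (ler_normD _ _) _; rewrite mulrDl mul1r lerD//.
  by apply: le_trans (kJ _) _; rewrite ler_pM2l.
pose m1 i (u : A * A) : R := l i (Q u).
pose m2 i (u : A * A) : R := - l i (J ** Q u).
have m1D i (x y : A * A) : m1 i (x + y) = m1 i x + m1 i y by rewrite /m1 QD lD.
have m1Z i (a : R) (x : A * A) : m1 i (a *: x) = a * m1 i x by rewrite /m1 QZ lZ.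
have m2D i (x y : A * A) : m2 i (x + y) = m2 i x + m2 i y by rewrite /m2 QD amulDr lD opprD.
have m2Z i (a : R) (x : A * A) : m2 i (a *: x) = a * m2 i x.
  by rewrite /m2 QZ amulZr lZ mulrN.
have K0 i x : `|l i x| <= `|K| * `|x|.
  by apply: le_trans (lK i x) _; rewrite ler_wpM2r// ler_norm.
pose k1 := `|K| * (1 + k).
have m1k i (x : A * A) : `|m1 i x| <= k1 * `|x|.
  by apply: le_trans (K0 i _) _; rewrite /k1 -mulrA ler_wpM2l.
pose k2 := `|K| * (k * (1 + k)).
have m2k i (x : A * A) : `|m2 i x| <= k2 * `|x|.
  rewrite normrN; apply: le_trans (K0 i _) _; rewrite /k2 -mulrA ler_wpM2l//.
  by apply: le_trans (kJ _) _; rewrite -mulrA ler_pM2l.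
have CR (z : R * R) : D z ->
    ('D_(1, 0) F z).1 = ('D_(0, 1) F z).2 /\ ('D_(1, 0) F z).2 = - ('D_(0, 1) F z).1.
  move=> /F0 /eqP; rewrite /dbar scaler_eq0 invr_eq0 pnatr_eq0/= addr_eq0 => /eqP ->.
  by rewrite /cimul /= opprK.
pose a i (z : R * R) := m1 i ('D_(1, 0) F z).
pose b i (z : R * R) := m1 i ('D_(0, 1) F z).
have m2a i (z : R * R) : D z -> m2 i ('D_(1, 0) F z) = - b i z.
  move=> /CR; rewrite /m2 /b /m1 /Q.
  move: ('D_(1, 0) F z) ('D_(0, 1) F z) => [X1 X2] [Y1 Y2] /= [-> ->].
  by rewrite amulDr (amul_im_unitK _ _ hJ) opprK addrC.
have m2b i (z : R * R) : D z -> m2 i ('D_(0, 1) F z) = a i z.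
  move=> /CR; rewrite /m2 /a /m1 /Q.
  move: ('D_(1, 0) F z) ('D_(0, 1) F z) => [X1 X2] [Y1 Y2] /= [-> ->].
  by rewrite amulDr (amul_im_unitK _ _ hJ) amulNr -lN opprD opprK addrC.
(* Near w the partial derivatives exceed their values at w by less than 1 in norm. The radius is a
   quarter of that neighbourhood's, as the Cauchy estimates need a box of half-side 4r. *)
have [r r0 [M [rD rM1 rM2]]] : exists2 r : R, 0 < r & exists M : R,
    [/\ forall z : R * R, `|z.1 - w.1| < 4 * r /\ `|z.2 - w.2| < 4 * r -> D z,
        forall z : R * R, `|z.1 - w.1| < 4 * r /\ `|z.2 - w.2| < 4 * r ->
          `|'D_(1, 0) F z| <= M &
        forall z : R * R, `|z.1 - w.1| < 4 * r /\ `|z.2 - w.2| < 4 * r ->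
          `|'D_(0, 1) F z| <= M].
  have [_ _ c1 c2] := C1 w Dw.
  have n1 : \forall z \near w, `|'D_(1, 0) F w - 'D_(1, 0) F z| < 1.
    by move/cvgrPdist_lt : c1 => /(_ 1 ltr01).
  have n2 : \forall z \near w, `|'D_(0, 1) F w - 'D_(0, 1) F z| < 1.
    by move/cvgrPdist_lt : c2 => /(_ 1 ltr01).
  have n3 : \forall z \near w, D z by apply: open_nbhs_nbhs; split.
  have n123 : \forall z \near w, (`|'D_(1, 0) F w - 'D_(1, 0) F z| < 1 /\
      `|'D_(0, 1) F w - 'D_(0, 1) F z| < 1) /\ D z.
    exact: filterI (filterI n1 n2) n3.
  move: n123 => /nbhs_ballP[d /= d0 dP].
  have bd (z : R * R) : `|z.1 - w.1| < 4 * (d / 4) /\ `|z.2 - w.2| < 4 * (d / 4) ->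
      ball w d z.
    have -> : 4 * (d / 4) = d by field.
    by move=> [z1 z2]; split; rewrite /ball/= distrC.
  have tri (x y : A * A) : `|x - y| < 1 -> `|y| <= `|x| + 1.
    move=> xy; have := ler_normD x (y - x); rewrite addrC subrK distrC; lra.
  exists (d / 4); first by rewrite divr_gt0.
  exists (`|'D_(1, 0) F w| + `|'D_(0, 1) F w| + 1); split => z /bd /dP[[h1 h2] h3] //.
    by apply: le_trans (tri _ _ h1) _; rewrite lerD2r lerDl normr_ge0.
  by apply: le_trans (tri _ _ h2) _; rewrite lerD2r lerDr normr_ge0.
have k10 : 0 <= k1 by rewrite /k1 mulr_ge0// addr_ge0// ltW.
have /choice[alpha alphaP] : forall i, exists alpha : nat -> C, forall zeta : C,
    normc zeta < r ->
    series (fun n => Re (alpha n * zeta ^+ n)) @ \oo -->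
      m1 i (F (w.1 + Re zeta, w.2 + Im zeta)) /\
    series (fun n => Im (alpha n * zeta ^+ n)) @ \oo -->
      m2 i (F (w.1 + Re zeta, w.2 + Im zeta)).
  move=> i.
  apply: (holomorphic_series (fun z : R * R => m1 i (F z)) (fun z : R * R => m2 i (F z)) (a i) (b i)
    w.1 w.2 r (k1 * M)) => //.
  - move=> z /rD Dz; have [d1 d2 _ _] := C1 z Dz; split.
      exact: is_derive_partial1 (m1D i) (m1Z i) (m1k i) F z d1.
    exact: is_derive_partial2 (m1D i) (m1Z i) (m1k i) F z d2.
  - move=> z /rD Dz; have [d1 d2 _ _] := C1 z Dz; rewrite -m2a// -m2b//; split.
      exact: is_derive_partial1 (m2D i) (m2Z i) (m2k i) F z d1.
    exact: is_derive_partial2 (m2D i) (m2Z i) (m2k i) F z d2.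
  - move=> z /rD Dz; have [_ _ c1 _] := C1 z Dz.
    exact: (bounded_functional_cvg (m1 i) k1 (m1D i) (m1Z i) (m1k i) _ _ _ c1).
  - move=> z /rD Dz; have [_ _ _ c1] := C1 z Dz.
    exact: (bounded_functional_cvg (m1 i) k1 (m1D i) (m1Z i) (m1k i) _ _ _ c1).
  - by move=> z /rM1 zM; apply: le_trans (m1k i _) _; rewrite ler_wpM2l.
  - by move=> z /rM2 zM; apply: le_trans (m1k i _) _; rewrite ler_wpM2l.
(* The e_i span A over the reals, not freely over the complex numbers: the sums of l_i(v) e_i and of
   -l_i(Jv) J e_i both equal v, hence the factor 1/2. *)
exists r => //; exists (fun n0 => 2^-1 *: \sum_(i < n) act J (alpha i n0) (e i)).
move=> z zr; set zeta := z - to_complex w in zr *.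
have zE : (Re z, Im z) = (w.1 + Re zeta, w.2 + Im zeta).
  rewrite /zeta; case: (z) => z1 z2 /=; congr pair; ring.
rewrite zE -/(Q _); set u := F _.
have -> : Q u = 2^-1 *: \sum_(i < n) (m1 i u *: e i + m2 i u *: (J ** e i)).
  have QE : \sum_(i < n) m1 i u *: e i = Q u by rewrite -lE.
  have JQE : \sum_(i < n) m2 i u *: (J ** e i) = Q u.
    rewrite -[RHS]opprK -(amul_im_unitK J (Q u) hJ) (lE (J ** Q u)).
    have Jsum N (s : 'I_N -> R) (h : 'I_N -> A) :
        J ** (\sum_(i < N) s i *: h i) = \sum_(i < N) s i *: (J ** h i).
      elim: N s h => [|N IH] s h; first by rewrite !big_ord0 amulx0.
      by rewrite !big_ord_recl amulDr amulZr IH.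
    by rewrite Jsum -sumrN; apply: eq_bigr => i _; rewrite /m2 scaleNr.
  by rewrite big_split/= QE JQE; vec; field.
have -> : series (fun n0 => act J (zeta ^+ n0)
      (2^-1 *: (\sum_(i < n) act J (alpha i n0) (e i)))) =
    fun N => 2^-1 *: \sum_(i < n) (series (fun n0 => Re (alpha i n0 * zeta ^+ n0)) N *: e i +
      series (fun n0 => Im (alpha i n0 * zeta ^+ n0)) N *: (J ** e i)).
  apply/funext => N; rewrite /series/=.
  have -> : \sum_(i < n) ((\sum_(0 <= n0 < N) Re (alpha i n0 * zeta ^+ n0)) *: e i +
      (\sum_(0 <= n0 < N) Im (alpha i n0 * zeta ^+ n0)) *: (J ** e i)) =
      \sum_(i < n) \sum_(0 <= n0 < N) act J (alpha i n0 * zeta ^+ n0) (e i).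
    by apply: eq_bigr => i _; rewrite !scaler_suml -big_split.
  rewrite exchange_big/= scaler_sumr; apply: eq_bigr => j _.
  have actZ (c : C) (s : R) x : act J c (s *: x) = s *: act J c x.
    by rewrite /act amulZr; vec; ring.
  have act0 (c : C) : act J c 0 = 0 by rewrite /act amulx0 !scaler0 addr0.
  rewrite actZ; congr (_ *: _).
  have actD x y : act J (zeta ^+ j) (x + y) = act J (zeta ^+ j) x + act J (zeta ^+ j) y.
    by have := act_linear J (zeta ^+ j) 1 x y; rewrite !scale1r.
  rewrite (big_morph _ actD (act0 _)).
  by apply: eq_bigr => i _; rewrite mulrC actM.
apply: cvgZl_tmp.
apply: (cvg_sum_ord \oo n (fun i N => series (fun n0 => Re (alpha i n0 * zeta ^+ n0)) N *: e i +
      series (fun n0 => Im (alpha i n0 * zeta ^+ n0)) N *: (J ** e i))) => i.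
have [h1 h2] := alphaP i zeta zr.
by apply: cvgD; apply: cvgZr_tmp; [exact: h1|exact: h2].
Qed.

(** * Between slice regularity and sigma-analyticity *)

Lemma series_linear (L : A -> A) (u : nat -> A) (a : A) : linear L ->
  series u @ \oo --> a -> series (fun n => L (u n)) @ \oo --> L a.
Proof.
move=> linL ua.
have -> : series (fun n => L (u n)) = fun N => L (series u N).
  apply/funext => N; rewrite /series/=.
  have L0 : L 0 = 0.
    by have := linL (-1) 0 0; rewrite scaler0 addr0 scaleN1r addNr.
  have LD x y : L (x + y) = L x + L y by have := linL 1 x y; rewrite !scale1r.
  by rewrite (big_morph _ LD L0).
exact: linear_cvg _ _ fin_dim linL _ _ _ _ _ ua.
Qed.

Lemma seriesD (V : normedModType R) (f g : nat -> V) (l m : V) :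
  series f @ \oo --> l -> series g @ \oo --> m ->
  series (fun n => f n + g n) @ \oo --> l + m.
Proof.
move=> fl gm; have -> : series (fun n => f n + g n) = series f + series g.
  by apply/funext => n; rewrite /series/= big_split.
exact: cvgD.
Qed.

Lemma slice_monomial_cvg J K a b p q (s : nat -> A) (g g' : A) :
  im_units E J -> im_units E K ->
  let z := a +i* b in let w := p +i* q in
  series (fun n => act J ((z - w) ^+ n) (s n)) @ \oo --> g ->
  series (fun n => act J ((z^*%C - w) ^+ n) (s n)) @ \oo --> g' ->
  series (fun n => slice_monomial E (sp p q J) n (s n) (sp a b K)) @ \oo -->
    to_unit J K g + to_unitc J K g'.
Proof.
move=> hJ hK z w sg sg'.
under eq_fun do rewrite slice_monomialE//.
apply: seriesD.
  exact: series_linear (to_unit_linear J K) sg.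
exact: series_linear (to_unitc_linear J K) sg'.
Qed.

Lemma slice_monomial_slice J a b p q n v : im_units E J ->
  slice_monomial E (sp p q J) n v (sp a b J) =
  act J (((a +i* b) - (p +i* q)) ^+ n) v.
Proof. by move=> hJ; rewrite slice_monomialE// to_unit_id// to_unitc_id// addr0. Qed.

Lemma induces_slice_point (D : set (R * R)) F (f : A -> A) K a b :
  induces E D F f -> im_units E K -> D (a, b) ->
  f (sp a b K) = (F (a, b)).1 + K ** (F (a, b)).2.
Proof.
move=> [stF fF] hK Dab; rewrite fF; last by exists a, b, K.
by have [? ?] := stF _ Dab; rewrite slice_extE.
Qed.

Lemma stem_transfer J K x1 x2 : im_units E J -> im_units E K ->
  to_unit J K (x1 + J ** x2) + to_unitc J K (x1 + J ** (- x2)) = x1 + K ** x2.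
Proof.
move=> hJ hK; rewrite /to_unit /to_unitc !amulE !amul_im_unitK// !amulE.
by vec; field.
Qed.

Lemma slice_regular_sigma_analytic (D : set (R * R)) (f : A -> A) :
  open D -> (forall z : R * R, D z -> D (cpx_conj z)) ->
  slice_regular E D f -> sigma_analytic E (Omega E D) f.
Proof.
move=> Do Dc [F [Ff C1 F0]] y [p [q [J [Dpq hJ ->]]]].
have [r0 r00 [s sG]] := holomorphic_has_pseries D F J (p, q) hJ Do C1 F0 Dpq.
have nD : \forall z \near (p, q), D z by apply: open_nbhs_nbhs; split.
(* [r0] is a radius of convergence, and [r1] keeps the sigma-ball inside Omega D. *)
have [r1 r10 r1D] := near_complexP (p, q) D nD.
have r_gt0 : 0 < Num.min r0 r1 by rewrite lt_min r00.
exists (Num.min r0 r1), s; split.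
- by exists (sp p q J); apply: sigma_ball_slice; rewrite // subrr normc0.
- move=> x /(sigma_ballP _ _ _ _ _ hJ)[a [b [K [hK -> ab]]]].
  exists a, b, K; split => //; apply: r1D.
  by case: ab => [[_]|[]] ab *; apply: lt_le_trans ab _; rewrite ge_min lexx orbT.
move=> x [/(sigma_ballP _ _ _ _ _ hJ)[a [b [K [hK -> ab]]]] _].
have lt0 u : u < Num.min r0 r1 -> u < r0.
  by move=> ur; apply: lt_le_trans ur _; rewrite ge_min lexx.
have lt1 u : u < Num.min r0 r1 -> u < r1.
  by move=> ur; apply: lt_le_trans ur _; rewrite ge_min lexx orbT.
have Dab : D (a, b) by apply: r1D; case: ab => [[_]|[]] /lt1.
rewrite (induces_slice_point D F)//.
(* On the plane of J the series is an ordinary one at z; elsewhere it needs convergence at z and at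
   conj z, and the ball provides both. *)
case: ab => [[-> ab]|[ab ab']].
  under eq_fun do rewrite slice_monomial_slice//.
  exact: sG _ (lt0 _ ab).
have H := slice_monomial_cvg J K a b p q s _ _ hJ hK (sG _ (lt0 _ ab)) (sG _ (lt0 _ ab')).
have [stF _] := Ff; have [/= e1 e2] := stF _ Dab.
have FE : to_unit J K ((F (a, b)).1 + J ** (F (a, b)).2) +
    to_unitc J K ((F (a, - b)).1 + J ** (F (a, - b)).2) =
    (F (a, b)).1 + K ** (F (a, b)).2.
  by rewrite -/(cpx_conj (a, b)) e1 e2 stem_transfer.
by rewrite -FE; exact: H.
Qed.

Lemma sigma_analytic_pseries (D : set (R * R)) (f : A -> A) K (w : R * R) :
  sigma_analytic E (Omega E D) f -> im_units E K -> D w ->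
  has_pseries K (fun z => f (sp (Re z) (Im z) K)) (to_complex w).
Proof.
move=> fan hK Dw.
have [r [s [ne sub cv]]] := fan (sp w.1 w.2 K) (ex_intro _ w.1 (ex_intro _ w.2
  (ex_intro _ K (And3 (eq_ind_r D Dw (esym (surjective_pairing w))) hK erefl)))).
exists r; first exact: sigma_ball_radius ne.
exists s => z zw; have zE : z = Re z +i* Im z by case: (z).
have zb : sigma_ball E (sp w.1 w.2 K) r (sp (Re z) (Im z) K).
  by apply: sigma_ball_slice => //; rewrite -zE.
have := cv _ (conj zb (sub _ zb)).
by under eq_fun do rewrite slice_monomial_slice// -zE.
Qed.

(** A real centre has the same representation in every plane, so one coefficient sequence serves all
    units. This ties the planes together without assuming that f is a slice function. *)
Lemma sigma_analytic_real (D : set (R * R)) (f : A -> A) p :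
  im_units E !=set0 ->
  sigma_analytic E (Omega E D) f -> D (p, 0) ->
  exists2 r : R, 0 < r & exists s : nat -> A, forall K z, im_units E K ->
    normc (z - p%:C) < r ->
    series (fun n => act K ((z - p%:C) ^+ n) (s n)) @ \oo -->
      f (sp (Re z) (Im z) K).
Proof.
move=> [J0 hJ0] fan Dp.
have Op : Omega E D (sp p 0 J0) by exists p, 0, J0.
have [r [s [ne sub cv]]] := fan _ Op.
exists r; first exact: sigma_ball_radius ne.
exists s => K z hK zw; have zE : z = Re z +i* Im z by case: (z).
have spE : sp p 0 J0 = sp p 0 K by rewrite !slice_point_real.
rewrite spE in sub cv.
have zb : sigma_ball E (sp p 0 K) r (sp (Re z) (Im z) K).
  by apply: sigma_ball_slice => //; rewrite -zE.
have := cv _ (conj zb (sub _ zb)).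
by under eq_fun do rewrite slice_monomial_slice// -zE.
Qed.

Lemma has_pseriesB J (g h : C -> A) w : has_pseries J g w -> has_pseries J h w ->
  has_pseries J (fun z => g z - h z) w.
Proof.
move=> [r r0 [s sg]] [r' r'0 [s' sh]].
exists (Num.min r r'); first by rewrite lt_min r0.
exists (fun n => s n - s' n) => z; rewrite lt_min => /andP[zr zr'].
have -> : (fun n => act J ((z - w) ^+ n) (s n - s' n)) =
    fun n => act J ((z - w) ^+ n) (s n) - act J ((z - w) ^+ n) (s' n).
  by apply/funext => n; rewrite /act !amulE; vec; ring.
exact: seriesB (sg z zr) (sh z zr').
Qed.

Lemma normc_conj c : normc c^*%C = normc c.
Proof. by case: c => c1 c2 /=; rewrite sqrrN. Qed.

(** [to_unitc] is antilinear, and the conjugation inside its argument restores powers of z - w; the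
    coefficients are the transported sums of those at w and at conj w. *)
Lemma has_pseries_transfer J K (g : C -> A) w : im_units E J -> im_units E K ->
  has_pseries J g w -> has_pseries J g w^*%C ->
  has_pseries K (fun z => to_unit J K (g z) + to_unitc J K (g z^*%C)) w.
Proof.
move=> hJ hK [r r0 [s sg]] [r' r'0 [s' sg']].
exists (Num.min r r'); first by rewrite lt_min r0.
exists (fun n => to_unit J K (s n) + to_unitc J K (s' n)) => z.
rewrite lt_min => /andP[zr zr'].
have zr'' : normc (z^*%C - w^*%C) < r' by rewrite -rmorphB normc_conj.
have -> : (fun n => act K ((z - w) ^+ n) (to_unit J K (s n) + to_unitc J K (s' n))) =
    fun n => to_unit J K (act J ((z - w) ^+ n) (s n)) +
             to_unitc J K (act J ((z^*%C - w^*%C) ^+ n) (s' n)).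
  apply/funext => n; rewrite to_unit_act// to_unitc_act//.
  rewrite -rmorphB -rmorphXn conjcK.
  by have := act_linear K ((z - w) ^+ n) 1 (to_unit J K (s n)) (to_unitc J K (s' n));
    rewrite !scale1r.
apply: seriesD.
  exact: series_linear (to_unit_linear J K) (sg z zr).
exact: series_linear (to_unitc_linear J K) (sg' _ zr'').
Qed.

Lemma sigma_analytic_slice (D : set (R * R)) (f : A -> A) J K (p : R) :
  open D -> (forall z : R * R, D z -> D (cpx_conj z)) ->
  connected (Omega E D) -> D (p, 0) -> sigma_analytic E (Omega E D) f ->
  im_units E J -> im_units E K -> forall z : R * R, D z ->
  f (sp z.1 z.2 K) = to_unit J K (f (sp z.1 z.2 J)) +
                     to_unitc J K (f (sp z.1 (- z.2) J)).
Proof.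
move=> Do Dc conn Dp fan hJ hK.
pose G I z := f (sp (Re z) (Im z) I).
(* The defect of the representation formula, analytic for the structure of K around every point of
   D. *)
pose g z := G K z - (to_unit J K (G J z) + to_unitc J K (G J z^*%C)).
have gps (w : R * R) : D w -> has_pseries K g (to_complex w).
  move=> Dw; apply: has_pseriesB; first exact: sigma_analytic_pseries fan hK Dw.
  apply: has_pseries_transfer => //.
    exact: sigma_analytic_pseries fan hJ Dw.
  exact: sigma_analytic_pseries fan hJ (Dc w Dw).
pose S := [set z : R * R | D z /\ \forall u \near z, g (to_complex u) = 0].
have S0 (z : R * R) : S z -> g (to_complex z) = 0 by move=> [_ /nbhs_singleton].
have So : open S.
  rewrite openE => z [Dz nz]; have nD : \forall u \near z, D u.
    by apply: open_nbhs_nbhs; split.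
  by apply: filterS2 nD (nbhs_interior nz).
(* Were z a limit of points of [S], zeros of [g] other than z would accumulate at z, and
   [pseries_identity] would put z in [S]. *)
have No : open (D `\` S).
  rewrite openE => z [Dz nSz].
  have nD : \forall u \near z, D u by apply: open_nbhs_nbhs; split.
  suff nS : \forall u \near z, ~ S u by apply: filterS2 nD nS.
  apply: contrapT => H; apply: (nSz); split => //.
  have [del0 del0P|r r0 gr] := pseries_identity K g (to_complex z) hK (gps z Dz).
    apply: contrapT => H'; apply: H.
    apply: filterS (near_to_complex z del0 del0P) => u uz Su; apply: H'.
    exists (to_complex u); split; [|exact: uz|exact: S0].
    apply/eqP => /(congr1 (fun c => (Re c, Im c))) /= uzE; apply: nSz.
    by rewrite [z]surjective_pairing -uzE -surjective_pairing.
  apply: filterS (near_to_complex z r r0) => u uz; apply: gr.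
  exact: ltW uz.
have cc : continuous (cpx_conj : R * R -> R * R).
  move=> z; apply: cvg_pair_nbhs; first exact: cvg_fst.
  by apply: cvgN; exact: cvg_snd.
have conjK (z : R * R) : cpx_conj (cpx_conj z) = z.
  by apply: injective_projections => //=; rewrite opprK.
(* [pr] below only sees (a, |b|); symmetry of [S'] lets membership be read at (a, b) again. *)
pose S' := S `&` cpx_conj @^-1` S.
have S'o : open S'.
  by apply: openI => //; apply: open_comp => // z _; exact: cc.
have N'o : open (D `\` S').
  have -> : D `\` S' = (D `\` S) `|` cpx_conj @^-1` (D `\` S).
    apply/seteqP; split => z.
      move=> [Dz nz]; have [Sz|nSz] := pselect (S z); last by left.
      by right; split; [exact: Dc|move=> Scz; apply: nz].
    move=> [[Dz nSz]|[Dz nSz]]; split => //; first by move=> [].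
      by rewrite -(conjK z); exact: Dc.
    by move=> [].
  by apply: openU => //; apply: open_comp => // z _; exact: cc.
(* The real part of a point is a multiple of [one] in A; a functional normalized at [one] turns it
   into a number. *)
have [l [linl l1]] : exists l : A -> R, linear (l : A -> R^o) /\ l one = 1.
  have [n [e [l [k [llin _ lE]]]]] := bounded_coordinates fin_dim.
  have [i li] : exists i, l i one != 0.
    apply: contrapT => H; move: (aone_neq0 E); rewrite (lE one) big1 ?eqxx// => i _.
    have [->|li] := eqVneq (l i one) 0; first by rewrite scale0r.
    by exfalso; apply: H; exists i.
  exists (fun x => (l i one)^-1 * l i x); split; last by rewrite mulVf.
  by move=> a x y; rewrite llin /GRing.scale/=; ring.
pose pr x : R * R := (l (aRe E x), `|aIm E x|).
have pr_sp a b I : im_units E I -> pr (sp a b I) = (a, `|b|).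
  move=> hI; rewrite /pr slice_point_aRe// slice_point_aIm// norm_scale_im_unit//.
  have l0 : l 0 = 0.
    by have := linl (-1) 0 0; rewrite scaler0 addr0 scaleN1r addNr.
  by have := linl a one 0; rewrite !addr0 l0 addr0 l1 /GRing.scale/= mulr1 => ->.
have prc : continuous pr.
  move=> x; apply: cvg_pair_nbhs.
    have linR : linear (fun x => l (aRe E x) : R^o).
      move=> a y v; rewrite -linl; congr l; rewrite /aRe aconjD aconjZ.
      by vec; ring.
    exact: (linear_cvg R^o _ fin_dim linR _ _ _ id x).
  have linI : linear (aIm E).
    by move=> a y v; rewrite /aIm aconjD aconjZ; vec; ring.
  apply: (@cvg_norm _ A).
  exact: (linear_cvg A _ fin_dim linI _ _ _ id x).
have prD x : Omega E D x -> D (pr x).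
  move=> [a [b [I [Dab hI ->]]]]; rewrite pr_sp//.
  by have [b0|b0] := leP 0 b; [rewrite ger0_norm|rewrite ltr0_norm//; exact: Dc _ Dab].
(* The preimage of [S'] is shown to be non-empty, relatively open and relatively closed in the
   connected set Omega D. *)
have SE : Omega E D `&` pr @^-1` S' = Omega E D.
  apply: conn.
  - exists (sp p 0 J); split; first by exists p, 0, J.
    (* Around the real point the planes of J and K share the coefficients [s]; both transported
       series then carry the same power of z - p, and [to_unit] plus [to_unitc] is the identity. *)
    have Sp : S (p, 0).
      split => //.
      have [r r0 [s sr]] := sigma_analytic_real D f p (ex_intro _ J hJ) fan Dp.
      apply: filterS (near_to_complex (p, 0) r r0) => u uz.
      have uz' : normc ((to_complex u)^*%C - p%:C) < r.
        have -> : (to_complex u)^*%C - p%:C = (to_complex (u - (p, 0)))^*%C.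
          by apply: complex_ext => /=; ring.
        by rewrite normc_conj.
      have h1 := sr K (to_complex u) hK uz.
      have h2 := series_linear _ _ _ (to_unit_linear J K) (sr J (to_complex u) hJ uz).
      have h3 := series_linear _ _ _ (to_unitc_linear J K) (sr J _ hJ uz').
      have h4 := seriesD _ _ _ _ _ h2 h3.
      have E4 : (fun n => to_unit J K (act J ((to_complex u - p%:C) ^+ n) (s n)) +
          to_unitc J K (act J (((to_complex u)^*%C - p%:C) ^+ n) (s n))) =
          fun n => act K ((to_complex u - p%:C) ^+ n) (s n).
        apply/funext => n; rewrite to_unit_act// to_unitc_act//.
        have -> : ((((to_complex u)^*%C - p%:C) ^+ n)^*)%C = (to_complex u - p%:C) ^+ n.
          rewrite rmorphXn; congr (_ ^+ n).
          by apply: complex_ext => /=; ring.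
        have := act_linear K ((to_complex u - p%:C) ^+ n) 1 (to_unit J K (s n))
          (to_unitc J K (s n)).
        by rewrite !scale1r => <-; rewrite to_unitD.
      rewrite E4 in h4.
      by rewrite /g; apply/eqP; rewrite subr_eq0; apply/eqP; exact: (cvg_unique _ h1 h4).
    rewrite /= pr_sp// normr0; split => //=.
    by rewrite /cpx_conj/= oppr0.
  - by exists (pr @^-1` S') => //; apply: open_comp => // x _; exact: prc.
  - exists (~` (pr @^-1` (D `\` S'))).
      by apply: open_closedC; apply: open_comp => // x _; exact: prc.
    apply/seteqP; split => x [Ox].
      by move=> Sx; split => // -[_]; exact.
    move=> nx; split => //; apply: contrapT => nSx; apply: nx; split => //.
    exact: prD.
move=> z Dz.
have : Omega E D (sp z.1 z.2 J) by exists z.1, z.2, J; rewrite -surjective_pairing.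
rewrite -SE => -[_ /=]; rewrite pr_sp// => S'z.
have Sz : S z.
  case: z Dz S'z => z1 z2 _ /=; have [b0|b0] := leP 0 z2.
    by rewrite ger0_norm// => -[].
  by rewrite ltr0_norm// => -[_]; rewrite /= /cpx_conj /= opprK.
by have := S0 z Sz; rewrite /g => /eqP; rewrite subr_eq0 => /eqP.
Qed.

End SliceAlgebra.

Theorem theorem1p6 (R : realType) (A : normedModType R) (E : alt_star_alg A)
    (fin_dim : finite_dimensional A) (norm_compat : norm_compatible E)
    (im_units_neq0 : im_units E !=set0)
    (D : set (R * R)) (D_neq0 : D !=set0) (D_open : open D)
    (D_conj : forall z, D z -> D (cpx_conj z))
    (Omega_connected : connected (Omega E D))
    (f : A -> A) :
  (D `&` [set z | z.2 = 0] = set0 ->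
     (slice_regular E D f <->
      sigma_analytic E (Omega E D) f /\ slice_function E D f)) /\
  (D `&` [set z | z.2 = 0] !=set0 ->
     (slice_regular E D f <-> sigma_analytic E (Omega E D) f)).
Proof.
have [J hJ] := im_units_neq0.
have reg_an : slice_regular E D f -> sigma_analytic E (Omega E D) f.
  exact: slice_regular_sigma_analytic.
(* Both converses are reduced to the representation formula relative to one fixed unit [J]: a stem
   function supplies it in the first case, connectedness through a real point in the second. *)
have an_reg : sigma_analytic E (Omega E D) f ->
    (forall K (z : R * R), im_units E K -> D z ->
      f (slice_point E z.1 z.2 K) =
      to_unit E J K (f (slice_point E z.1 z.2 J)) +
      to_unitc E J K (f (slice_point E z.1 (- z.2) J))) ->
    slice_regular E D f.
  move=> fan; apply: slice_regular_of_pseries => // w Dw.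
  exact: sigma_analytic_pseries fan hJ Dw.
split=> [_|[[p q] [Dp /= q0]]].
  split=> [freg|[fan [F Ff]]].
    by split; [exact: reg_an|have [F [Ff _ _]] := freg; exists F].
  apply: an_reg => // K [a b] hK Dab; have [stF _] := Ff.
  have [/= e1 e2] := stF _ Dab.
  rewrite !(induces_slice_point _ _ _ D F)//; last exact: D_conj Dab.
  by rewrite e1 e2 stem_transfer.
split=> // fan; apply: an_reg => // K z hK Dz.
rewrite q0 in Dp.
exact: sigma_analytic_slice D_open D_conj Omega_connected Dp fan hJ hK z Dz.
Qed.
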